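(* Let $N\ge 3$ and $p>1$. For $\xi>0$ consider the Cauchy problem $$\left(\frac{u'}{\sqrt{1-(u')^2}}\right)'+\frac{N-1}{r}\frac{u'}{\sqrt{1-(u')^2}}+|u|^{p-1}u=0\ \ (r>0),\qquad u'(0)=0,\qquad u(0)=\xi.$$ Every sign-changing (maximal) solution of this Cauchy problem, for any $\xi>0$, is global (i.e. defined on all of $[0,+\infty)$) and satisfies $u(r)\to 0$ as $r\to+\infty$. In particular, the problem $$\nabla\cdot\left[\frac{\nabla u}{\sqrt{1-|\nabla u|^2}}\right]+|u|^{p-1}u=0\ \text{ in }\mathbb{R}^N,\qquad u^{\pm}\not\equiv 0\ \text{ in }\mathbb{R}^N,\qquad u(x)\to 0\ \text{ as }|x|\to\infty$$ has infinitely many radial solutions for any $p>1$.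
   Context: Solutions are understood in the classical sense, with $|u'|<1$ (respectively $|\nabla u|<1$). $u^{+}$ and $u^{-}$ are the positive and negative parts of $u$, so $u^\pm\not\equiv0$ means that $u$ takes both positive and negative values (i.e. $u$ is sign-changing). For each $\xi>0$ the Cauchy problem has a unique solution on a maximal interval $[0,R_\xi)$. A radial function on $\mathbb{R}^N$ is identified with a function of $r=|x|$. *)

(* Defs.v *)
From HB Require Import structures.
From mathcomp Require Import all_boot all_order all_algebra.
From mathcomp Require Import all_classical all_reals all_analysis.

Set Implicit Arguments.
Unset Strict Implicit.
Unset Printing Implicit Defensive.

Import Order.TTheory GRing.Theory Num.Theory.
Import numFieldNormedType.Exports.

Local Open Scope classical_set_scope.
Local Open Scope ring_scope.

Section Radial.
Context {R : realType}.
Implicit Types (N : nat) (p xi r : R) (T : \bar R) (u v : R -> R).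

(* For p > 1 the power vanishes at 0, since 0 `^ a = 0 when a != 0. *)
Definition nonlin p (s : R) : R := `|s| `^ (p - 1) * s.

Definition radial_flux u r : R := derive1 u r / Num.sqrt (1 - derive1 u r ^+ 2).

(* A classical solution on [0, T[, with T possibly +oo. Values of u outside
   [0, T[ are irrelevant, so the derivative at 0 is the right derivative;
   u is C^1 on [0, T[ and C^2 on ]0, T[. *)
Definition cauchy_solution N p xi T u : Prop :=
  [/\ (0 < T)%E,
      u 0 = xi,
      (u h - u 0) / h @[h --> 0^'+] --> (0 : R),
      derive1 u h @[h --> 0^'+] --> (0 : R) &
      forall r, 0 < r -> (r%:E < T)%E ->
        [/\ derivable u r 1,
            derivable (derive1 u) r 1,
            continuous_at r (derive1n 2 u),
            `|derive1 u r| < 1 &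
            derive1 (radial_flux u) r + (N%:R - 1) / r * radial_flux u r
              + nonlin p (u r) = 0]].

Definition maximal_cauchy_solution N p xi T u : Prop :=
  cauchy_solution N p xi T u /\
  forall T' v, (T < T')%E -> cauchy_solution N p xi T' v ->
    ~ (forall r, 0 <= r -> (r%:E < T)%E -> v r = u r).

Definition sign_changing_on T u : Prop :=
  (exists r, [/\ 0 <= r, (r%:E < T)%E & 0 < u r]) /\
  (exists r, [/\ 0 <= r, (r%:E < T)%E & u r < 0]).

End Radial.

Section Space.
Context {R : realType} {N : nat}.
Implicit Types (u : 'rV[R]_N -> R) (F : 'rV[R]_N -> 'rV[R]_N) (x : 'rV[R]_N).

(* The library's norm on row vectors is the sup norm. *)
Definition enorm x : R := Num.sqrt (\sum_i x 0 i ^+ 2).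

Definition partial (i : 'I_N) u : 'rV[R]_N -> R := 'D_(delta_mx 0 i) u.

Definition grad u x : 'rV[R]_N := \row_i partial i u x.

Definition divergence F x : R := \sum_i partial i (fun y => F y 0 i) x.

Definition classC1 u : Prop :=
  continuous u /\
  forall i, (forall x, derivable u x (delta_mx 0 i)) /\ continuous (partial i u).

Definition classC2 u : Prop := classC1 u /\ forall i, classC1 (partial i u).

Definition flux u x : 'rV[R]_N :=
  (Num.sqrt (1 - enorm (grad u x) ^+ 2))^-1 *: grad u x.

Definition radial u : Prop := exists f : R -> R, forall x, u x = f (enorm x).

Definition vanishes_at_infinity u : Prop :=
  forall e : R, 0 < e ->
    \forall M \near +oo, forall x, M <= enorm x -> `|u x| < e.

Definition sign_changing_pde_solution (p : R) u : Prop :=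
  [/\ classC2 u,
      forall x, enorm (grad u x) < 1,
      forall x, divergence (flux u) x + nonlin p (u x) = 0,
      u^\+ <> cst 0 /\ u^\- <> cst 0 &
      vanishes_at_infinity u].

End Space.

(* Main.v *)
(* With the flux W = u' / sqrt (1 - u'^2), so that u' = W / sqrt (1 + W^2), the
   equation is the system W' = - (N - 1) W / r - f(u). Since |u'| < 1 always, a
   solution stays bounded on bounded intervals; the Picard iteration, which is a
   contraction for a weight exp (lam r) on every [0, b[, gives existence and
   uniqueness on [0, +oo[, so maximal solutions are global.

   Decay: the energy E = sqrt (1 + W^2) - 1 + u f(u) / (p + 1) decreases, with
   E' = - (N - 1) W u' / r. If E >= e > 0, then E + W u / r has derivative at most
   - e / r + K / r^2, hence tends to - oo like - e ln r although it is bounded.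
   So E tends to 0, and u with it.

   Infinitely many solutions: for large u(0) = xi, the solution is at least xi / 2
   on [0, xi / 2], which makes W so negative that u' <= - 1 / 2 from then on, and u
   changes sign before 4 xi. The function u(|x|) is C^2 because W / r, W' and u''
   have the same limit - f(xi) / N at 0. *)
Require Import Defs.
From HB Require Import structures.
From mathcomp Require Import all_boot all_order all_algebra.
From mathcomp Require Import all_classical all_reals all_analysis.
From mathcomp Require Import ring lra.

Import Order.TTheory GRing.Theory Num.Theory.
Import numFieldNormedType.Exports.

Local Open Scope classical_set_scope.
Local Open Scope ring_scope.

(** * Calculus on the half-line *)

Section RealCalculus.
Context {R : realType}.
Implicit Types (f g : R -> R) (x y a b l r : R).

(** The coefficient (N - 1) / r is singular at 0 and solutions are differentiated only on ]0, T[, so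
    initial data enter as right limits. Estimates near 0 share one shape: a function with a known
    limit at 0 and a derivative of constant sign, after multiplication by r ^ (N - 1) when the
    singular term is present. In the flux variable, u' is a bounded, 1-Lipschitz function of W. The
    bound |u - xi| <= r that follows makes the superlinear f Lipschitz on the range that matters, so
    one contraction covers any bounded interval.

    In the decay, friction controls W u' but says nothing about the potential part of E. The product
    W u repairs this: its derivative contains - u f(u), at the cost of an extra W u'. After division
    by r the friction pays for that cost, because N - 1 >= 2 leaves a coefficient at least 1 on W
    u', and W u' + u f(u) >= E. *)

Lemma is_derive_add f g x a b : is_derive x 1 f a -> is_derive x 1 g b ->
  is_derive x 1 (fun y => f y + g y) (a + b).
Proof. by move=> fa gb; exact: is_deriveD. Qed.

Lemma is_derive_sub f g x a b : is_derive x 1 f a -> is_derive x 1 g b ->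
  is_derive x 1 (fun y => f y - g y) (a - b).
Proof. by move=> fa gb; exact: is_deriveB. Qed.

Lemma is_derive_opp f x a : is_derive x 1 f a ->
  is_derive x 1 (fun y => - f y) (- a).
Proof. by move=> fa; exact: is_deriveN. Qed.

Lemma is_derive_mul f g x a b : is_derive x 1 f a -> is_derive x 1 g b ->
  is_derive x 1 (fun y => f y * g y) (a * g x + f x * b).
Proof.
move=> fa gb; have := is_deriveM (f := f) (g := g) (x := x) (v := 1).
move=> /(_ _ _ fa gb) h; apply: is_derive_eq; rewrite /GRing.scale /=; ring.
Qed.

Lemma is_derive_const c x : is_derive x 1 (fun=> c : R) 0.
Proof. exact: is_derive_cst. Qed.

Lemma is_derive_var x : is_derive x 1 (fun y => y) 1.
Proof. exact: is_derive_id. Qed.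

Lemma is_derive_scale c f x a : is_derive x 1 f a ->
  is_derive x 1 (fun y => c * f y) (c * a).
Proof.
move=> fa; have := is_derive_mul (fun=> c) f x 0 a (is_derive_const c x) fa.
by rewrite mul0r add0r.
Qed.

Lemma is_derive_pow n x : is_derive x 1 (fun y => y ^+ n) (n%:R * x ^+ n.-1).
Proof.
have := @is_deriveX R R id n x 1 1 (is_derive_id _ _).
by rewrite /GRing.scale /= mulr1 exprfctE.
Qed.

Lemma is_derive_comp f g x a b : is_derive (g x) 1 f a -> is_derive x 1 g b ->
  is_derive x 1 (fun y => f (g y)) (a * b).
Proof. by move=> fa gb; exact: is_derive1_comp. Qed.

Lemma is_derive_inv f x a : f x != 0 -> is_derive x 1 f a ->
  is_derive x 1 (fun y => (f y)^-1) (- a / f x ^+ 2).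
Proof.
move=> f0 fa; have := is_deriveV f0 fa.
by rewrite /GRing.scale /= mulNr [_ * a]mulrC mulNr.
Qed.

Lemma is_derive_expM c x :
  is_derive x 1 (fun y => expR (c * y)) (c * expR (c * x)).
Proof.
have /= := is_derive_comp expR (fun y => c * y) x _ _ (is_derive_expR _)
  (is_derive_scale c id x 1 (is_derive_id _ _)).
by rewrite mulr1 mulrC.
Qed.

Lemma is_derive_continuous f x a : is_derive x 1 f a -> {for x, continuous f}.
Proof. by case=> df _; exact/differentiable_continuous/derivable1_diffP. Qed.

Lemma mean_value f (df : R -> R) a b : a <= b ->
    (forall x, a <= x <= b -> is_derive x 1 f (df x)) ->
  exists2 c, a <= c <= b & f b - f a = df c * (b - a).
Proof.
move=> ab fD; have [||c] := @MVT_segment R f df a b ab.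
- by move=> x; rewrite in_itv /= => /andP[ax xb]; apply: fD; rewrite !ltW.
- apply: derivable_within_continuous => x; rewrite in_itv /= => /fD.
  by case.
- by rewrite in_itv /=; exists c.
Qed.

(** The limit at 0 stands in for an initial value: [f r <= f h] for all small [h], by the mean value
    theorem, and [h] tends to 0. *)
Lemma le_right_limit f (df : R -> R) b l : f h @[h --> 0^'+] --> l ->
    (forall r, 0 < r < b -> is_derive r 1 f (df r)) ->
    (forall r, 0 < r < b -> df r <= 0) ->
  forall r, 0 < r < b -> f r <= l.
Proof.
move=> fl fD df0 r /andP[r0 rb].
rewrite -(cvg_lim _ fl)//; apply: limr_ge; first by apply/cvg_ex; exists l.
near=> h.
have h0 : 0 < h by near: h; exact: nbhs_right_gt.
have hr : h <= r by near: h; exact: nbhs_right_le.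
have hx x : h <= x <= r -> 0 < x < b.
  by case/andP=> hx xr; rewrite (lt_le_trans h0 hx) (le_lt_trans xr rb).
have [c hcr fE] := mean_value f df h r hr (fun x hx' => fD x (hx x hx')).
by rewrite -subr_le0 fE mulr_le0_ge0 ?df0 ?hx// subr_ge0.
Unshelve. all: by end_near. Qed.

Lemma expr_right_limit0 k : (0 < k)%N -> (h : R) ^+ k @[h --> 0^'+] --> (0 : R).
Proof.
move=> k0; apply: cvg_at_right_filter.
have := @exprn_continuous R k 0; rewrite /continuous_at expr0n.
by rewrite eqn0Ngt k0.
Qed.

(* The hypothesis says that [r ^+ k * D r] is nonincreasing; it vanishes at 0. *)
Lemma radial_comparison k b (D dD : R -> R) l : (0 < k)%N ->
    D h @[h --> 0^'+] --> l ->
    (forall r, 0 < r < b -> is_derive r 1 D (dD r)) ->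
    (forall r, 0 < r < b -> dD r + k%:R / r * D r <= 0) ->
  forall r, 0 < r < b -> D r <= 0.
Proof.
move=> k0 Dl DD dD0 r rb; have r0 : 0 < r by case/andP: rb.
suff : r ^+ k * D r <= 0 by rewrite pmulr_rle0// exprn_gt0.
have fl : h ^+ k * D h @[h --> 0^'+] --> (0 : R).
  rewrite -[X in _ --> X](mul0r l).
  exact: cvgM (expr_right_limit0 k k0) Dl.
apply: (le_right_limit (fun h => h ^+ k * D h)
  (fun h => h ^+ k * (dD h + k%:R / h * D h)) b 0 fl) rb => s sb.
- have s0 : s != 0 by rewrite gt_eqF//; case/andP: sb.
  apply: is_derive_eq; first exact: is_derive_mul (is_derive_pow k s) (DD s sb).
  case: k k0 {dD0 fl} => // k _ /=; rewrite exprS; field.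
  by [].
- rewrite pmulr_rle0 ?dD0// exprn_gt0//; by case/andP: sb.
Qed.

(** [2 * C / 2 ^+ n] is the sum of all later increments, so subtracting it from [x n] gives an
    increasing sequence [y] and adding it a decreasing one [z]. The limit is caught between them, as
    the supremum of [y]. *)
Lemma half_geometric_limit (x : nat -> R) (C : R) :
    (forall n, `|x n.+1 - x n| <= C / 2 ^+ n) ->
  forall n, `|x n - limn x| <= 2 * C / 2 ^+ n.
Proof.
move=> xC.
pose y n := x n - 2 * C / 2 ^+ n; pose z n := x n + 2 * C / 2 ^+ n.
have C0 : 0 <= C by have := le_trans (normr_ge0 _) (xC 0); rewrite expr0 divr1.
have q0 n : 0 <= 2 * C / 2 ^+ n :> R.
  by rewrite divr_ge0 ?mulr_ge0 ?exprn_ge0.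
have qS n : 2 * C / 2 ^+ n.+1 = C / 2 ^+ n :> R.
  by rewrite exprS; field; rewrite expf_neq0.
have q2 n : 2 * C / 2 ^+ n = C / 2 ^+ n + C / 2 ^+ n :> R.
  by field; rewrite expf_neq0.
have yS m n : (m <= n)%N -> y m <= y n.
  move: m n; apply: (homo_leq (r := fun a b : R => a <= b)) => [//|? ? ?|k].
    exact: le_trans.
  have := xC k; rewrite /y qS q2 ler_norml => /andP[+ _]; lra.
have zS m n : (m <= n)%N -> z n <= z m.
  move: m n; apply: (homo_leq (r := fun a b : R => b <= a)) => [//|? ? ? ba cb|k].
    exact: le_trans cb ba.
  have := xC k; rewrite /z qS q2 ler_norml => /andP[_]; lra.
have yz m n : y m <= z n.
  apply: (le_trans (yS m (maxn m n) (leq_maxl _ _))).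
  apply: le_trans (zS n (maxn m n) (leq_maxr _ _)).
  have := q0 (maxn m n); rewrite /y /z; lra.
pose l := sup (range y).
have ly n : y n <= l.
  apply: ub_le_sup; last by exists n.
  by exists (z 0) => _ [m _ <-]; exact: yz.
have lz n : l <= z n.
  by apply: ge_sup; [exists (y 0); exists 0|move=> _ [m _ <-]; exact: yz].
have xl n : `|x n - l| <= 2 * C / 2 ^+ n.
  rewrite ler_distlC; have := ly n; have := lz n; rewrite /y /z; lra.
suff -> : limn x = l by [].
apply: cvg_lim => //; apply/cvgrPdist_le => e e0.
have : (2 * C) * 2^-1 ^+ n @[n --> \oo] --> (0 : R).
  rewrite -(mulr0 (2 * C)); apply: cvgM; first exact: cvg_cst.
  by apply: cvg_expr; rewrite ger0_norm ?invr_ge0// invf_lt1// ltr1n.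
move/cvgrPdist_le => /(_ e e0); apply: filterS => n.
rewrite sub0r normrN ger0_norm exprVn ?q0// => qe.
by rewrite distrC; exact: le_trans (xl n) qe.
Qed.

Lemma continuous_extension g l : (forall r, 0 < r -> {for r, continuous g}) ->
  g h @[h --> 0^'+] --> l ->
  continuous (fun r : R => if 0 < r then g r else l).
Proof.
move=> gc gl r; have [r0|r0|->] := ltgtP r 0.
- rewrite /continuous_at ltNge (ltW r0) /=.
  apply/cvgrPdist_le => e e0; near=> h.
  suff -> : (0 < h) = false by rewrite subrr normr0 ltW.
  by apply/negbTE; rewrite -leNgt ltW//; near: h; exact: lt_nbhsl.
- rewrite /continuous_at r0.
  apply: (@cvg_trans _ (g h @[h --> r])); last exact: gc.
  apply: near_eq_cvg; near=> h; rewrite ifT//.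
  by near: h; exact: lt_nbhsr.
- rewrite /continuous_at ltxx; apply/cvgrPdist_le => e e0.
  have gle : \forall h \near nbhs (0 : R), 0 < h -> `|l - g h| <= e.
    by have /cvgrPdist_le/(_ e e0) := gl; rewrite /at_right near_withinE.
  near=> h; case: ifP => [h0|_]; last by rewrite subrr normr0 ltW.
  by move: h0; near: h.
Unshelve. all: by end_near. Qed.

(** A nonnegative [q] approaches 0 only from the right, so the right limit of [g] suffices there.
    Used with [q] the absolute value or the Euclidean norm. *)
Lemma continuous_nonneg_comp {T : topologicalType} g (q : T -> R) (z : T) :
    (forall r, 0 < r -> {for r, continuous g}) -> g h @[h --> 0^'+] --> g 0 ->
    (forall w, 0 <= q w) -> q @ z --> q z ->
  (fun w => g (q w)) @ z --> g (q z).
Proof.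
move=> gc g0 q0 qc; pose ge r := if 0 < r then g r else g 0.
have geE w : g (q w) = ge (q w).
  rewrite /ge; case: ltP => // /(conj (q0 w))/andP.
  by rewrite -eq_le => /eqP <-.
rewrite geE; under eq_fun do rewrite geE.
exact: (continuous_cvg _ (continuous_extension g _ gc g0 _) qc).
Qed.

Lemma cvg0_dominated {T : topologicalType} (f1 f2 : T -> R) (z : T) :
  (forall w, `|f1 w| <= `|f2 w|) -> f2 @ z --> (0 : R) -> f1 @ z --> (0 : R).
Proof.
move=> f12 f20; apply/cvgrPdist_le => e e0.
have /cvgrPdist_le/(_ e e0) := f20; apply: filterS => w.
by rewrite !sub0r !normrN; apply: le_trans.
Qed.

(** The constant extension of [g] to the left of 0 is continuous on the line, and the fundamental
    theorem of calculus applies to it. *)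
Lemma right_antiderivative g l : (forall r, 0 < r -> {for r, continuous g}) ->
    g h @[h --> 0^'+] --> l ->
  exists2 G, G h @[h --> 0^'+] --> (0 : R) &
    forall r, 0 < r -> is_derive r 1 G (g r).
Proof.
move=> gc gl; pose ge r := if 0 < r then g r else l.
have gec : continuous ge by exact: continuous_extension.
have gi b : lebesgue_measure.-integrable `[0, b] (EFin \o ge).
  apply: continuous_compact_integrable; first exact: segment_compact.
  exact: continuous_subspaceT.
exists (fun x => parameterized_integral lebesgue_measure 0 x ge).
  exact/cvg_at_right_filter/(parameterized_integral_cvg_left ltr01).
move=> r r0.
have r1 : r < r + 1 by rewrite ltrDl.
have [//|d dE] := continuous_FTC1_closed r1 (gi (r + 1)) r0 _; first exact: gec.
apply: DeriveDef; first exact: d.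
by rewrite -derive1E dE /ge r0.
Qed.

End RealCalculus.

(** * The mean curvature and power nonlinearities *)

(** Inverse of v |-> v / sqrt (1 - v^2): it recovers u' from the flux. *)
Definition mcurv {R : realType} (w : R) : R := w / Num.sqrt (1 + w ^+ 2).

Section MeanCurvature.
Context {R : realType}.
Implicit Types (w v s t : R).

Lemma sqr1D_gt0 w : 0 < 1 + w ^+ 2.
Proof. by rewrite ltr_wpDr ?sqr_ge0. Qed.

Lemma sqrt1D_gt0 w : 0 < Num.sqrt (1 + w ^+ 2).
Proof. by rewrite sqrtr_gt0 sqr1D_gt0. Qed.

Lemma sqrt1D_sqr w : Num.sqrt (1 + w ^+ 2) ^+ 2 = 1 + w ^+ 2.
Proof. by rewrite sqr_sqrtr// ltW// sqr1D_gt0. Qed.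

Lemma is_derive_sqrt1D w :
  is_derive w 1 (fun w => Num.sqrt (1 + w ^+ 2)) (mcurv w).
Proof.
have h : is_derive w 1 (fun w => 1 + w ^+ 2) (0 + 2%:R * w ^+ 1).
  exact: is_derive_add (is_derive_const 1 w) (is_derive_pow 2 w).
have := is_derive_comp Num.sqrt (fun w => 1 + w ^+ 2) w _ _
  (is_derive1_sqrt (sqr1D_gt0 w)) h.
move=> {}h; apply: is_derive_eq; rewrite /mcurv; field.
by rewrite gt_eqF ?sqrt1D_gt0.
Qed.

Lemma is_derive_mcurv w :
  is_derive w 1 mcurv ((1 + w ^+ 2) * Num.sqrt (1 + w ^+ 2))^-1.
Proof.
have s0 : Num.sqrt (1 + w ^+ 2) != 0 by rewrite gt_eqF ?sqrt1D_gt0.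
have h := is_derive_mul id (fun w => (Num.sqrt (1 + w ^+ 2))^-1) w _ _
  (is_derive_id w 1) (is_derive_inv (fun w => Num.sqrt (1 + w ^+ 2)) _ _ s0
     (is_derive_sqrt1D w)).
apply: is_derive_eq; rewrite /= /mcurv.
have e := sqrt1D_sqr w; set q := Num.sqrt _ in s0 e *.
rewrite -e; transitivity ((q ^+ 2 - w * w) / (q ^+ 2 * q)); first by field.
by rewrite e -expr2 addrK mul1r.
Qed.

(** The derivative (1 + c^2)^(-3/2) lies between 0 and 1. *)
Lemma mcurv_dist w v : `|mcurv w - mcurv v| <= `|w - v|.
Proof.
wlog wv : w v / v <= w => [hw|].
  case/orP: (le_total v w) => h; first exact: hw.
  by rewrite distrC (distrC w) hw.
have [c _ ->] := mean_value mcurv _ v w wv (fun x _ => is_derive_mcurv x).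
rewrite normrM ler_piMl// ger0_norm ?invr_ge0 ?mulr_ge0 ?sqrtr_ge0//.
- have h : 1 <= 1 + c ^+ 2 by rewrite lerDl sqr_ge0.
  rewrite invf_le1 ?mulr_gt0 ?sqrt1D_gt0 ?sqr1D_gt0//.
  by rewrite mulr_ege1// -[leLHS]sqrtr1 ler_sqrt// ltW ?sqr1D_gt0.
- by rewrite ltW ?sqr1D_gt0.
Qed.

Lemma mcurv_le w v : w <= v -> mcurv w <= mcurv v.
Proof.
move=> wv; rewrite -subr_ge0.
have [c _ ->] := mean_value mcurv _ w v wv (fun x _ => is_derive_mcurv x).
rewrite mulr_ge0 ?subr_ge0// invr_ge0 mulr_ge0 ?sqrtr_ge0//.
exact/ltW/sqr1D_gt0.
Qed.

Lemma mcurv0 : mcurv 0 = 0 :> R. Proof. by rewrite /mcurv mul0r. Qed.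

Lemma continuous_mcurv : continuous (@mcurv R).
Proof. move=> w; exact: is_derive_continuous (is_derive_mcurv w). Qed.

Lemma one_sub_mcurv_sqr w : 1 - mcurv w ^+ 2 = (1 + w ^+ 2)^-1.
Proof.
rewrite /mcurv exprMn exprVn sqrt1D_sqr; field.
by rewrite gt_eqF ?sqr1D_gt0.
Qed.

Lemma mcurv_lt1 w : `|mcurv w| < 1.
Proof.
rewrite -(ltr_pXn2r (n := 2)) ?nnegrE// real_normK ?num_real// expr1n.
by rewrite -subr_gt0 one_sub_mcurv_sqr invr_gt0 sqr1D_gt0.
Qed.

Lemma mcurvK w : mcurv w / Num.sqrt (1 - mcurv w ^+ 2) = w.
Proof.
rewrite one_sub_mcurv_sqr sqrtrV ?ltW ?sqr1D_gt0// invrK /mcurv divfK//.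
by rewrite gt_eqF ?sqrt1D_gt0.
Qed.

Lemma mcurv_flux v : `|v| < 1 -> mcurv (v / Num.sqrt (1 - v ^+ 2)) = v.
Proof.
move=> v1.
have v0 : 0 < 1 - v ^+ 2.
  by rewrite subr_gt0 -real_normK ?num_real// expr_lt1.
have s0 : 0 < Num.sqrt (1 - v ^+ 2) by rewrite sqrtr_gt0.
rewrite /mcurv; have -> : 1 + (v / Num.sqrt (1 - v ^+ 2)) ^+ 2 = (1 - v ^+ 2)^-1.
  rewrite exprMn exprVn sqr_sqrtr ?(ltW v0)//; field.
  by rewrite gt_eqF.
by rewrite sqrtrV ?(ltW v0)// invrK divfK// gt_eqF.
Qed.

Lemma mcurv_le_half w : w <= -1 -> mcurv w <= - 2^-1.
Proof.
move=> w1; rewrite /mcurv ler_pdivrMr ?sqrt1D_gt0//.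
suff : Num.sqrt (1 + w ^+ 2) <= -2 * w by lra.
rewrite -(ler_pXn2r (n := 2)) ?nnegrE ?sqrtr_ge0 ?sqrt1D_sqr//; first nra.
lra.
Qed.

End MeanCurvature.

Section PowerNonlinearity.
Context {R : realType} (p : R).
Hypothesis p1 : 1 < p.
Implicit Types (s t M : R).

Lemma nonlin0 : nonlin p 0 = 0. Proof. by rewrite /nonlin mulr0. Qed.

Lemma nonlinN s : nonlin p (- s) = - nonlin p s.
Proof. by rewrite /nonlin normrN mulrN. Qed.

Lemma nonlin_ge0 s : 0 <= s -> nonlin p s = s `^ p.
Proof.
by move=> s0; rewrite /nonlin ger0_norm// mulrC mulr_powRB1// (lt_trans _ p1).
Qed.

(** Negative [s] reduces to positive [s] by oddness. At 0 the difference quotient is |z|^(p - 1),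
    which tends to 0 because p > 1. *)
Lemma is_derive_nonlin s : is_derive s 1 (nonlin p) (p * `|s| `^ (p - 1)).
Proof.
have pos t : 0 < t -> is_derive t 1 (nonlin p) (p * `|t| `^ (p - 1)).
  move=> t0; rewrite gtr0_norm//.
  have := is_derive1_powR p t0; apply: near_eq_is_derive.
  by near=> z; rewrite nonlin_ge0// ltW//; near: z; exact: lt_nbhsr.
have [s0|s0|->] := ltgtP s 0; last 2 first.
- exact: pos.
- apply/is_derive1_caratheodory; exists (fun z => `|z| `^ (p - 1)); split.
  + by move=> z; rewrite nonlin0 !subr0.
  + have p10 : p - 1 != 0 by rewrite subr_eq0 gt_eqF.
    rewrite /prop_for /continuous_at normr0 powR0//; apply/cvgrPdist_le => e e0.
    have ple : \forall h \near nbhs (0 : R), 0 < h -> `|0 - h `^ (p - 1)| <= e.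
      have /cvgrPdist_le/(_ e e0) : a `^ (p - 1) @[a --> 0^'+] --> (0 : R).
        by apply: powR_cvg0; rewrite subr_gt0.
      by rewrite /at_right near_withinE.
    have nle : \forall z \near nbhs (0 : R),
        0 < `|z| -> `|0 - `|z| `^ (p - 1)| <= e.
      have : (Num.norm : R -> R) @ (0 : R) --> `|0 : R|.
        exact: norm_continuous.
      by rewrite normr0 => /(_ _ ple).
    near=> z; have [->|z0] := eqVneq z 0.
      by rewrite normr0 powR0// subrr normr0 ltW.
    have : 0 < `|z| by rewrite normr_gt0.
    by near: z.
  + by rewrite normr0 powR0 ?mulr0// subr_eq0 gt_eqF.
- have Ns : 0 < - s by rewrite oppr_gt0.
  have := is_derive_opp _ _ _ (is_derive_comp (nonlin p) (fun z => - z) s _ _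
    (pos _ Ns) (is_derive_opp id s 1 (is_derive_id _ _))).
  rewrite normrN mulrN1 opprK.
  by under eq_fun do rewrite nonlinN opprK.
Unshelve. all: by end_near. Qed.

Lemma continuous_nonlin : continuous (nonlin p).
Proof. move=> s; exact: is_derive_continuous (is_derive_nonlin s). Qed.

(** [nonlin p s * s] is |s|^(p + 1). In this product form both terms of the derivative are multiples
    of [nonlin p s], with coefficients p and 1. *)
Lemma is_derive_potential s :
  is_derive s 1 (fun s => nonlin p s * s / (p + 1)) (nonlin p s).
Proof.
have h := is_derive_scale (p + 1)^-1 (fun s => nonlin p s * s) s _
  (is_derive_mul _ id _ _ _ (is_derive_nonlin s) (is_derive_id s 1)).
have e : (fun s => nonlin p s * s / (p + 1)) =
  (fun s => (p + 1)^-1 * (nonlin p s * s)) by apply/funext => z; rewrite mulrC.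
rewrite e; apply: is_derive_eq; rewrite /nonlin /=; field.
by rewrite gt_eqF//; move: p1; lra.
Qed.

Lemma nonlin_lipschitz M : 0 <= M -> forall s t, `|s| <= M -> `|t| <= M ->
  `|nonlin p s - nonlin p t| <= p * M `^ (p - 1) * `|s - t|.
Proof.
move=> M0 s t; wlog st : s t / t <= s => [hw|].
  case/orP: (le_total t s) => h sM tM; first exact: hw.
  by rewrite distrC (distrC s) hw.
move=> sM tM; have [c /andP[tc cs] ->] :=
  mean_value (nonlin p) _ t s st (fun x _ => is_derive_nonlin x).
have cM : `|c| <= M.
  move: sM tM; rewrite !ler_norml => /andP[sM1 sM2] /andP[tM1 tM2].
  by apply/andP; split; lra.
have p0 : 0 <= p by move: p1; lra.
rewrite normrM ler_wpM2r// ger0_norm ?mulr_ge0 ?powR_ge0//.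
rewrite ler_wpM2l// ge0_ler_powR ?nnegrE//.
by move: p1; lra.
Qed.

Lemma nonlin_mul_ge0 s : 0 <= nonlin p s * s.
Proof. by rewrite /nonlin -mulrA mulr_ge0 ?powR_ge0 ?sqr_ge0// -expr2 sqr_ge0. Qed.

End PowerNonlinearity.

(** * Picard iteration *)

(* [u] is obtained from [a] by one Picard iteration on [0, b[; a fixed point
   [a = u] is a solution, with [W] the flux [u' / sqrt (1 - u'^2)]. *)
Definition picard_step {R : realType} (k : nat) (f : R -> R) (xi b : R)
    (a u W : R -> R) : Prop :=
  [/\ u h @[h --> 0^'+] --> xi, W h @[h --> 0^'+] --> (0 : R) &
    forall r, 0 < r < b -> is_derive r 1 u (mcurv (W r)) /\
      is_derive r 1 W (- (k%:R / r * W r) - f (a r))].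

Section Picard.
Context {R : realType} (k : nat) (f : R -> R).
Hypothesis k0 : (0 < k)%N.
Implicit Types (xi b r x y C L lam : R) (a u W v : R -> R).

Lemma picard_step_dist0 xi b a u W : picard_step k f xi b a u W ->
  forall r, 0 < r < b -> `|u r - xi| <= r.
Proof.
move=> [uxi _ uW] r rb.
(* Taking [s] to be 1 and -1 yields both sides of the absolute value from one monotonicity
   argument. *)
have bnd (s : R) : `|s| = 1 -> forall r, 0 < r < b -> s * u r - r <= s * xi.
  move=> s1; have l : s * u h - h @[h --> 0^'+] --> s * xi.
    rewrite -[X in _ --> X]subr0; apply: cvgB; first exact: cvgM (cvg_cst _) uxi.
    exact/cvg_at_right_filter/cvg_id.
  apply: (le_right_limit _ (fun r => s * mcurv (W r) - 1) b _ l) => t tb.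
    apply: is_derive_sub (is_derive_id _ _).
    exact: is_derive_scale (proj1 (uW t tb)).
  rewrite subr_le0 (le_trans (ler_norm _))// normrM s1 mul1r.
  exact/ltW/mcurv_lt1.
have := bnd 1 (normr1 _) r rb; have := bnd (-1) _ r rb.
by rewrite normrN1 => /(_ erefl); rewrite ler_norml; lra.
Qed.

Lemma picard_step_lipschitz xi b a u W : picard_step k f xi b a u W ->
  forall x y, 0 < x -> x <= y -> y < b -> `|u y - u x| <= y - x.
Proof.
move=> [_ _ uW] x y x0 xy yb.
have [|c _ ->] := mean_value u (fun r => mcurv (W r)) x y xy.
  move=> r /andP[xr ry]; apply: (proj1 (uW r _)).
  by rewrite (lt_le_trans x0 xr) (le_lt_trans ry yb).
rewrite normrM [X in _ * X]ger0_norm ?subr_ge0// ler_piMl ?subr_ge0//.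
exact/ltW/mcurv_lt1.
Qed.

Lemma expM_right_limit C c : C * expR (c * h) @[h --> (0 : R)^'+] --> C.
Proof.
have {2}-> : C = C * expR (c * 0) by rewrite mulr0 expR0 mulr1.
apply: cvg_at_right_filter.
exact: (is_derive_continuous _ _ _
  (is_derive_scale C _ _ _ (is_derive_expM c 0))).
Qed.

(** Each of the two integrations of the weight gains a factor 1 / lam: [W1 - W2] is at most (L C /
    lam) exp (lam r), the singular term having the good sign, and then [u1 - u2] is at most (L C /
    lam^2) exp (lam r). The condition on [lam] turns L / lam^2 into 1/2. *)
Lemma picard_step_contract xi b L lam C a1 u1 W1 a2 u2 W2 :
    0 <= L -> 0 < lam -> 2 * L <= lam ^+ 2 -> 0 <= C ->
    picard_step k f xi b a1 u1 W1 -> picard_step k f xi b a2 u2 W2 ->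
    (forall r, 0 < r < b ->
       `|f (a1 r) - f (a2 r)| <= L * (C * expR (lam * r))) ->
  forall r, 0 < r < b -> `|u1 r - u2 r| <= C / 2 * expR (lam * r).
Proof.
move=> L0 lam0 Llam C0.
(* One side is enough, the hypotheses being symmetric in the two steps. *)
suff half a1' u1' W1' a2' u2' W2' : picard_step k f xi b a1' u1' W1' ->
    picard_step k f xi b a2' u2' W2' ->
    (forall r, 0 < r < b ->
       `|f (a1' r) - f (a2' r)| <= L * (C * expR (lam * r))) ->
    forall r, 0 < r < b -> u1' r - u2' r <= C / 2 * expR (lam * r).
  move=> s1 s2 fC r rb.
  have h1 := half _ _ _ _ _ _ s1 s2 fC r rb.
  have h2 := half _ _ _ _ _ _ s2 s1
    (fun r rb => eq_ind_r (fun z => z <= _) (fC r rb) (distrC _ _)) r rb.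
  by rewrite ler_norml; apply/andP; split; lra.
move=> {a1 u1 W1 a2 u2 W2}.
move: a1' u1' W1' a2' u2' W2' => a1 u1 W1 a2 u2 W2.
move=> [u1l W1l uW1] [u2l W2l uW2] fC.
have lamN0 : lam != 0 by rewrite gt_eqF.
pose q := L * C / lam.
have q0 : 0 <= q by rewrite divr_ge0 ?mulr_ge0// ltW.
have WD : forall r, 0 < r < b -> W1 r - W2 r - q * expR (lam * r) <= 0.
  apply: (radial_comparison k b _ (fun r => (- (k%:R / r * W1 r) - f (a1 r))
    - (- (k%:R / r * W2 r) - f (a2 r)) - q * (lam * expR (lam * r)))
    (0 - 0 - q)) => // [|r rb|r rb].
  - by apply: cvgB (expM_right_limit _ _); exact: cvgB.
  - apply: is_derive_sub; last exact: is_derive_scale (is_derive_expM _ _).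
    exact: is_derive_sub (proj2 (uW1 r rb)) (proj2 (uW2 r rb)).
  - have r0 : 0 < r by case/andP: rb.
    have := fC r rb; rewrite ler_norml => /andP[fC1 _].
    have e : q * lam = L * C by rewrite /q divfK.
    have kr : 0 <= k%:R / r * (q * expR (lam * r)).
      rewrite mulr_ge0//; first by rewrite divr_ge0// ltW.
      by rewrite mulr_ge0 ?expR_ge0.
    move: fC1; rewrite !mulrA -e; move: kr; rewrite !mulrBr; lra.
have l : u1 h - u2 h - q / lam * expR (lam * h) @[h --> 0^'+]
    --> xi - xi - q / lam.
  by apply: cvgB (expM_right_limit _ _); exact: cvgB.
have uD : forall r, 0 < r < b ->
    u1 r - u2 r - q / lam * expR (lam * r) <= xi - xi - q / lam.
  apply: (le_right_limit _ (fun r => mcurv (W1 r) - mcurv (W2 r)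
    - q / lam * (lam * expR (lam * r))) _ _ l) => r rb.
  - apply: is_derive_sub; last exact: is_derive_scale (is_derive_expM _ _).
    exact: is_derive_sub (proj1 (uW1 r rb)) (proj1 (uW2 r rb)).
  - rewrite mulrA divfK//.
    have qe : 0 <= q * expR (lam * r) by rewrite mulr_ge0 ?expR_ge0.
    (* [WD] bounds the difference only from above: where it is negative the monotonicity of [mcurv]
       is used, elsewhere its Lipschitz constant 1. *)
    have [h|h] := leP (W1 r) (W2 r).
      suff : mcurv (W1 r) <= mcurv (W2 r) by lra.
      exact: mcurv_le.
    have := WD r rb; have := mcurv_dist (W1 r) (W2 r).
    rewrite (ger0_norm (x := W1 r - W2 r)) ?subr_ge0 ?(ltW h)// ler_norml.
    by move=> /andP[_]; lra.
move=> r rb; have := uD r rb; rewrite subrr sub0r => h.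
have qlam0 : 0 <= q / lam by rewrite divr_ge0// ltW.
suff qC : q / lam * expR (lam * r) <= C / 2 * expR (lam * r) by lra.
rewrite ler_wpM2r ?expR_ge0// /q -mulrA -invfM -expr2 ler_pdivrMr ?exprn_gt0//.
nra.
Qed.

(** With the integrating factor [r ^+ k] the flux equation reads (r^k W)' = - r^k f(a), so two
    successive antiderivatives give [W] and then [u]. *)
Lemma picard_step_exists xi a : continuous (fun r => f (a r)) ->
  exists uW : (R -> R) * (R -> R), [/\ forall b, picard_step k f xi b a uW.1 uW.2,
    forall r, r <= 0 -> uW.1 r = xi &
    forall x y, `|uW.1 x - uW.1 y| <= `|x - y|].
Proof.
move=> fac.
have gc : continuous (fun r => r ^+ k * f (a r)).
  by move=> r; apply: cvgM; [exact: exprn_continuous|exact: fac].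
have [|G G0 GD] := right_antiderivative (fun r => r ^+ k * f (a r))
  (0 ^+ k * f (a 0)) (fun r _ => gc r).
  by apply: cvg_at_right_filter; exact: gc.
pose W r := - (G r / r ^+ k).
have WD r : 0 < r -> is_derive r 1 W (- (k%:R / r * W r) - f (a r)).
  move=> r0; have rN0 : r != 0 by rewrite gt_eqF.
  have rk0 : r ^+ k != 0 by rewrite expf_neq0.
  have h := is_derive_opp _ _ _ (is_derive_mul _ _ _ _ _ (GD r r0)
    (is_derive_inv (fun r => r ^+ k) _ _ rk0 (is_derive_pow k r))).
  apply: is_derive_eq; rewrite /W.
  move: k0 rk0; case: (k) => // n _ /=; rewrite exprS => rk0; field.
  by move: rk0; rewrite mulf_eq0 negb_or => /andP[-> ->].
(* Near 0 the integrand is at most M r^k, so |G| <= M r^(k + 1) and |W| <= M r. *)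
have W0 : W h @[h --> 0^'+] --> (0 : R).
  pose M := `|f (a 0)| + 1.
  have M0 : 0 <= M by rewrite addr_ge0.
  have [d d0 fM] : exists2 d, 0 < d & forall r, 0 < r < d -> `|f (a r)| <= M.
    have /cvgrPdist_le/(_ _ ltr01)/nbhs_ballP[d /= d0 dP] := fac 0.
    exists d => // r /andP[r0 rd].
    have := dP r; rewrite /ball /= sub0r normrN gtr0_norm// => /(_ rd).
    rewrite /M => h; rewrite -lerBlDl.
    by apply: le_trans (lerB_dist _ _) _; rewrite distrC.
  have GM (s : R) : `|s| = 1 -> forall r, 0 < r < d -> s * G r - M * r ^+ k.+1 <= 0.
    move=> s1; have l : s * G h - M * h ^+ k.+1 @[h --> 0^'+] --> s * 0 - M * 0.
      apply: cvgB; first exact: cvgM (cvg_cst _) G0.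
      exact: cvgM (cvg_cst _) (expr_right_limit0 _ _).
    rewrite !mulr0 subr0 in l.
    apply: (le_right_limit _ (fun r => s * (r ^+ k * f (a r))
      - M * (k.+1%:R * r ^+ k)) _ _ l) => r rd.
      apply: is_derive_sub; apply: is_derive_scale; last exact: is_derive_pow.
      by apply: GD; case/andP: rd.
    have rk : 0 <= r ^+ k by rewrite exprn_ge0// ltW//; case/andP: rd.
    rewrite subr_le0 (le_trans (ler_norm _))// !normrM s1 mul1r (ger0_norm rk).
    have := fM r rd => fMr; have : 1 <= k.+1%:R :> R by rewrite ler1n.
    move=> k1; rewrite [leRHS]mulrA [leRHS]mulrC ler_wpM2l//.
    by rewrite (le_trans fMr)// ler_peMr.
  have GM2 r : 0 < r < d -> `|W r| <= M * r.
    move=> rd; have r0 : 0 < r by case/andP: rd.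
    rewrite /W normrN normrM normfV (gtr0_norm (exprn_gt0 k r0)).
    rewrite ler_pdivrMr ?exprn_gt0// -mulrA -exprS.
    have := GM 1 (normr1 _) r rd; have := GM (-1) _ r rd.
    by rewrite normrN1 => /(_ erefl); rewrite ler_norml; lra.
  have Mp : 0 < M by rewrite ltr_wpDl.
  apply/cvgrPdist_le => e e0; near=> h.
  have h0 : 0 < h by near: h; exact: nbhs_right_gt.
  rewrite sub0r normrN (le_trans (GM2 h _))//.
    by rewrite h0; near: h; exact: nbhs_right_lt.
  rewrite mulrC -ler_pdivlMr//; near: h; apply: nbhs_right_le.
  by rewrite divr_gt0.
have mWc r : 0 < r -> {for r, continuous (fun r => mcurv (W r))}.
  move=> r0; exact: is_derive_continuous
    (is_derive_comp mcurv W r _ _ (is_derive_mcurv _) (WD r r0)).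
have [H H0 HD] := right_antiderivative (fun r => mcurv (W r)) (mcurv 0) mWc
  (continuous_cvg _ (continuous_mcurv 0) W0).
(* Freezing [u] at [xi] on the left makes it 1-Lipschitz on the whole line, so that it can be fed to
   the next step. *)
pose u r := if 0 < r then xi + H r else xi.
have uE r : 0 < r -> u r = xi + H r by rewrite /u => ->.
have st b : picard_step k f xi b a u W.
  split=> [|//|r /andP[r0 _]].
    rewrite -[X in _ --> X]addr0.
    apply: cvg_trans (cvgD (cvg_cst xi) H0); apply: near_eq_cvg.
    by near=> h; rewrite uE//; near: h; exact: nbhs_right_gt.
  split; last exact: WD.
  apply: (near_eq_is_derive (f := fun r => xi + H r)).
    by near=> h; rewrite uE//; near: h; exact: lt_nbhsr.
  rewrite -[mcurv _]add0r.
  exact: is_derive_add (is_derive_const _ _) (HD r r0).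
have u0 r : r <= 0 -> u r = xi by move=> r0; rewrite /u ltNge r0.
exists (u, W); split => //= x y.
wlog xy : x y / y <= x => [hw|].
  case/orP: (le_total y x) => h; first exact: hw.
  by rewrite distrC (distrC x) hw.
rewrite [leRHS]ger0_norm ?subr_ge0//.
have x1 : x < x + 1 by rewrite ltrDl.
have [y0|y0] := ltP 0 y.
  exact: picard_step_lipschitz (st (x + 1)) y x y0 xy x1.
rewrite (u0 y y0); have [x0|x0] := ltP 0 x; last first.
  by rewrite (u0 x x0) subrr normr0 subr_ge0.
apply: le_trans (picard_step_dist0 _ _ _ _ _ (st (x + 1)) x _) _.
  by rewrite x0.
by rewrite lerDl oppr_ge0.
Unshelve. all: by end_near. Qed.

End Picard.

Section PicardFixpoint.
Context {R : realType} (k : nat) (f : R -> R).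
Hypothesis k0 : (0 < k)%N.
Implicit Types (xi b r x y C L lam K : R) (a u W v : R -> R).
Hypothesis f_lipschitz : forall M, 0 <= M -> exists2 L, 0 <= L &
  forall s t, `|s| <= M -> `|t| <= M -> `|f s - f t| <= L * `|s - t|.

Hypothesis f_continuous : continuous f.

Lemma le_halves x C : (forall n, x <= C / 2 ^+ n) -> x <= 0.
Proof.
move=> xC; have C0 : C * 2^-1 ^+ n @[n --> \oo] --> (0 : R).
  rewrite -[X in _ --> X](mulr0 C); apply: cvgM; first exact: cvg_cst.
  by apply: cvg_expr; rewrite ger0_norm ?invr_ge0// invf_lt1// ltr1n.
rewrite -(cvg_lim _ C0)//; apply: limr_ge; first by apply/cvg_ex; exists 0.
by apply: nearW => n; rewrite exprVn.
Qed.

(* The weight [expR (lam * r)] makes the Picard iteration on [0, b[ a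
   contraction of ratio 1/2, however long the interval. *)
Lemma picard_halving xi b : 0 <= b -> exists2 lam, 0 < lam &
  forall C a1 u1 W1 a2 u2 W2, 0 <= C ->
    picard_step k f xi b a1 u1 W1 -> picard_step k f xi b a2 u2 W2 ->
    (forall r, 0 < r < b -> `|a1 r| <= `|xi| + b) ->
    (forall r, 0 < r < b -> `|a2 r| <= `|xi| + b) ->
    (forall r, 0 < r < b -> `|a1 r - a2 r| <= C * expR (lam * r)) ->
  forall r, 0 < r < b -> `|u1 r - u2 r| <= C / 2 * expR (lam * r).
Proof.
move=> b0; have [|L L0 fL] := f_lipschitz (`|xi| + b); first by rewrite addr_ge0.
(* This choice of [lam] is positive even for L = 0, and its square exceeds 2 L. *)
have lam0 : 0 < 1 + 2 * L by rewrite ltr_pwDl// mulr_ge0.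
exists (1 + 2 * L) => // C a1 u1 W1 a2 u2 W2 C0 s1 s2 a1M a2M a12.
apply: (picard_step_contract k f k0 xi b L _ C _ _ _ _ _ _ L0 lam0 _ C0 s1 s2).
  by nra.
move=> r rb; apply: le_trans (fL _ _ (a1M r rb) (a2M r rb)) _.
by rewrite ler_wpM2l// a12.
Qed.

Lemma picard_step_bound xi b a u W : picard_step k f xi b a u W ->
  forall r, 0 < r < b -> `|u r| <= `|xi| + b.
Proof.
move=> st r rb; rewrite -[u r](subrK xi) addrC (le_trans (ler_normD _ _))// lerD2l.
apply: le_trans (picard_step_dist0 _ _ _ _ _ _ _ st r rb) _.
by case/andP: rb => _ /ltW.
Qed.

Lemma le_expM b lam r x : 0 <= lam -> 0 < r < b -> x <= b ->
  x <= b * expR (lam * r).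
Proof.
move=> lam0 /andP[r0 rb] xb; apply: (le_trans xb).
have b0 : 0 <= b by rewrite ltW// (lt_trans r0).
by rewrite ler_peMr// -expR0 ler_expR mulr_ge0// ltW.
Qed.

(** Two fixed points differ by at most 2 b, both being within b of [xi]. Each application of the
    step to the pair halves this bound without changing the pair. *)
Lemma picard_fixpoint_unique xi b u1 W1 u2 W2 :
    picard_step k f xi b u1 u1 W1 -> picard_step k f xi b u2 u2 W2 ->
  forall r, 0 < r < b -> u1 r = u2 r.
Proof.
move=> s1 s2 r rb; have b0 : 0 <= b by case/andP: rb => r0 /(lt_trans r0)/ltW.
have [lam lam0 lamP] := picard_halving xi b b0.
have u12 n : forall r, 0 < r < b ->
    `|u1 r - u2 r| <= 2 * b / 2 ^+ n * expR (lam * r).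
  elim: n => [|n IHn] x xb.
    rewrite expr0 divr1 -mulrA mulrC -ler_pdivrMr//.
    apply: le_expM => //; first exact: ltW.
    have := picard_step_dist0 _ _ _ _ _ _ _ s1 x xb.
    have := picard_step_dist0 _ _ _ _ _ _ _ s2 x xb.
    by case/andP: xb => x0 xb; rewrite ler_pdivrMr// !ler_norml; lra.
  have := lamP (2 * b / 2 ^+ n) _ _ _ _ _ _ _ s1 s2
    (picard_step_bound _ _ _ _ _ s1) (picard_step_bound _ _ _ _ _ s2) IHn x xb.
  move=> /(_ _)/le_trans; apply; first by rewrite divr_ge0 ?mulr_ge0 ?exprn_ge0.
  by rewrite exprSr invfM !mulrA.
apply/eqP; rewrite -subr_eq0 -normr_le0.
apply: (le_halves _ (2 * b * expR (lam * r))) => n.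
by apply: le_trans (u12 n r rb) _; rewrite mulrAC.
Qed.

Lemma picard_fixpoint_exists xi : exists uW : (R -> R) * (R -> R),
  [/\ forall b, picard_step k f xi b uW.1 uW.1 uW.2,
    forall r, r <= 0 -> uW.1 r = xi &
    forall x y, `|uW.1 x - uW.1 y| <= `|x - y|].
Proof.
(* This class is preserved by the step and by pointwise limits, and it makes [f \o a] continuous. *)
pose good a := forall x y, `|a x - a y| <= `|x - y|.
have fgood a : good a -> continuous (fun r => f (a r)).
  move=> ga r; apply: continuous_comp; last exact: f_continuous.
  apply/cvgrPdist_le => e e0; near=> x.
  by apply: le_trans (ga r x) _; near: x; exact: cvgr_dist_le.
(* A step is available only for good [a]; placing that condition under the existential lets [choice]
   produce a total map [F]. *)
have stepP a : exists uW : (R -> R) * (R -> R), good a ->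
    [/\ forall b, picard_step k f xi b a uW.1 uW.2,
      forall r, r <= 0 -> uW.1 r = xi & good uW.1].
  have [ga|nga] := pselect (good a); last by exists (a, a).
  by have [uW uWP] := picard_step_exists k f k0 xi a (fgood a ga); exists uW.
have [F FP] := choice stepP.
pose us n := iter n (fun a => (F a).1) (cst xi).
have us_good n : good (us n).
  elim: n => [|n IHn] x y; first by rewrite subrr normr0.
  by have [_ _] := FP _ IHn; exact.
have usP n b : picard_step k f xi b (us n) (us n.+1) (F (us n)).2.
  by have [+ _ _] := FP _ (us_good n); exact.
have us0 n r : r <= 0 -> us n r = xi.
  by case: n => // n r0; have [_ + _] := FP _ (us_good n); exact.
have usM n b r : 0 < r < b -> `|us n r| <= `|xi| + b.
  case: n => [|n] rb; last exact: picard_step_bound (usP n b) r rb.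
  by rewrite lerDl; case/andP: rb => r0 /(lt_trans r0)/ltW.
pose u r := limn (us ^~ r).
have usu b : 0 <= b -> exists2 lam, 0 <= lam & forall n r, 0 < r < b ->
    `|us n r - u r| <= 2 * b / 2 ^+ n * expR (lam * r).
  move=> b0; have [lam lam0 lamP] := picard_halving xi b b0.
  exists lam; first exact: ltW.
  have usS n : forall r, 0 < r < b ->
      `|us n.+1 r - us n r| <= b / 2 ^+ n * expR (lam * r).
    elim: n => [|n IHn] r rb.
      rewrite expr0 divr1; apply: le_expM => //; first exact: ltW.
      apply: le_trans (picard_step_dist0 _ _ _ _ _ _ _ (usP 0 b) r rb) _.
      by case/andP: rb => _ /ltW.
    have := lamP (b / 2 ^+ n) _ _ _ _ _ _ _ (usP n.+1 b) (usP n b)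
      (usM n.+1 b) (usM n b) IHn r rb.
    move=> /(_ _)/le_trans; apply; first by rewrite divr_ge0 ?exprn_ge0.
    by rewrite exprSr invfM !mulrA.
  move=> n r rb.
  have := half_geometric_limit (us ^~ r) (b * expR (lam * r)) _ n.
  rewrite mulrA [_ / _ * _]mulrAC; apply=> m.
  by rewrite mulrAC usS.
have usK r : exists K, forall n, `|us n r - u r| <= K / 2 ^+ n.
  have [r0|r0] := leP r 0.
    exists 0 => n; rewrite mul0r us0//.
    suff -> : u r = xi by rewrite subrr normr0.
    by apply: cvg_lim => //; under eq_fun do rewrite us0//; exact: cvg_cst.
  have r1 : 0 <= r + 1 by rewrite addr_ge0// ltW.
  have [lam _ lamP] := usu (r + 1) r1.
  exists (2 * (r + 1) * expR (lam * r)) => n; rewrite mulrAC lamP//.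
  by rewrite r0 ltrDl ltr01.
have u_good : good u.
  move=> x y; rewrite -subr_le0.
  have [Kx KxP] := usK x; have [Ky KyP] := usK y.
  apply: (le_halves _ (Kx + Ky)) => n.
  rewrite mulrDl; have := KxP n; have := KyP n; have := us_good n x y.
  have := ler_normD (us n x - us n y) (us n y - u y - (us n x - u x)).
  have := ler_normB (us n y - u y) (us n x - u x).
  have -> : us n x - us n y + (us n y - u y - (us n x - u x)) = u x - u y by ring.
  lra.
have u0 r : r <= 0 -> u r = xi.
  move=> r0; apply: cvg_lim => //.
  by under eq_fun do rewrite us0//; exact: cvg_cst.
have [FuP Fu0 Fu_good] := FP _ u_good.
have uM b r : 0 < r < b -> `|u r| <= `|xi| + b.
  move=> rb; have [K KP] := usK r; rewrite -subr_le0.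
  apply: (le_halves _ K) => n; have := KP n; have := usM n b r rb.
  have := ler_normB (us n r) (us n r - u r); rewrite subKr; lra.
(* As [us n] is close to [u], the contraction makes [us n.+1] close to [(F u).1]; but [us n.+1] also
   tends to [u]. *)
have Fu : (F u).1 = u.
  apply/funext => r; have [r0|r0] := leP r 0; first by rewrite Fu0// u0.
  have r1 : 0 <= r + 1 by rewrite addr_ge0// ltW.
  have rb : 0 < r < r + 1 by rewrite r0 ltrDl ltr01.
  have [lam1 lam10 lamP1] := usu (r + 1) r1.
  have [K KP] := usK r.
  have [lam2 lam20 lamP2] := picard_halving xi (r + 1) r1.
  (* The weights of the convergence and of the contraction may have different exponents [lam1] and
     [lam2]; on ]0, r + 1[ the first weight is absorbed into [C]. *)
  pose C := 2 * (r + 1) * expR (lam1 * (r + 1)).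
  have C0 : 0 <= C by rewrite mulr_ge0 ?expR_ge0 ?mulr_ge0.
  apply/eqP; rewrite -subr_eq0 -normr_le0.
  apply: (le_halves _ (C * expR (lam2 * r) + K)) => n.
  have Cn0 : 0 <= C / 2 ^+ n by rewrite divr_ge0 ?exprn_ge0.
  have usC s : 0 < s < r + 1 ->
      `|u s - us n s| <= C / 2 ^+ n * expR (lam2 * s).
    move=> sb; rewrite distrC; apply: le_trans (lamP1 n s sb) _.
    rewrite -[leLHS]mulr1 ler_pM ?mulr_ge0 ?expR_ge0 ?invr_ge0 ?exprn_ge0//.
      rewrite /C [leRHS]mulrAC ler_wpM2l ?ler_expR ?ler_wpM2l//.
        by rewrite divr_ge0 ?exprn_ge0 ?mulr_ge0.
      by case/andP: sb => _ /ltW.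
    rewrite -expR0 ler_expR mulr_ge0 ?(ltW lam20)//.
    by case/andP: sb => /ltW.
  have := lamP2 _ _ _ _ _ _ _ Cn0 (FuP (r + 1)) (usP n (r + 1))
    (uM (r + 1)) (usM n (r + 1)) usC r rb.
  have := KP n.+1; rewrite mulrDl.
  have := ler_normD ((F u).1 r - us n.+1 r) (us n.+1 r - u r).
  have -> : (F u).1 r - us n.+1 r + (us n.+1 r - u r) = (F u).1 r - u r by ring.
  have K0 : 0 <= K by have := le_trans (normr_ge0 _) (KP 0); rewrite expr0 divr1.
  have : K / 2 ^+ n.+1 <= K / 2 ^+ n.
    by rewrite ler_wpM2l// lef_pV2 ?posrE ?exprn_gt0// exprS ler_peMl ?exprn_ge0 ?ler1n.
  have e0 : 0 <= C / 2 ^+ n * expR (lam2 * r) by rewrite mulr_ge0 ?expR_ge0.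
  have -> : C / 2 ^+ n / 2 * expR (lam2 * r) = C / 2 ^+ n * expR (lam2 * r) / 2.
    by rewrite mulrAC.
  rewrite [C * expR _ / _]mulrAC; lra.
exists (u, (F u).2); split => // b.
by have := FuP b; rewrite Fu.
Unshelve. all: by end_near. Qed.

End PicardFixpoint.

(** * Radial solutions *)

(** For every e > 0, f - m r - e r is nonincreasing and f - m r + e r nondecreasing near 0, which
    puts the quotient within e of m. *)
Lemma right_derivative_limit {R : realType} (f df : R -> R) (b l m : R) :
    0 < b -> f h @[h --> 0^'+] --> l -> df h @[h --> 0^'+] --> m ->
    (forall r, 0 < r < b -> is_derive r 1 f (df r)) ->
  (f h - l) / h @[h --> 0^'+] --> m.
Proof.
move=> b0 fl dfm fD; apply/cvgrPdist_le => e e0.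
have [d d0 dP] : exists2 d, 0 < d & forall r, 0 < r < d -> `|m - df r| <= e.
  have /cvgrPdist_le/(_ e e0) := dfm.
  rewrite /at_right near_withinE => /nbhs_ballP[d /= d0 dP].
  exists d => // r /andP[r0 rd]; apply: dP => //.
  by rewrite /ball /= sub0r normrN gtr0_norm.
have bnd (s : R) : `|s| = 1 -> forall r, 0 < r < Num.min d b ->
    s * (f r - m * r) - e * r <= s * l.
  move=> s1; have lim : s * (f h - m * h) - e * h @[h --> 0^'+] --> s * l.
    have idl : (h : R) @[h --> 0^'+] --> (0 : R).
      exact/cvg_at_right_filter/cvg_id.
    have -> : s * l = s * (l - m * 0) - e * 0 by ring.
    apply: cvgB; last exact: cvgM (cvg_cst _) idl.
    by apply: cvgM (cvg_cst _) _; apply: cvgB fl _; exact: cvgM (cvg_cst _) idl.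
  apply: (le_right_limit _ (fun r => s * (df r - m * 1) - e * 1) _ _ lim).
    move=> r /andP[r0]; rewrite lt_min => /andP[rd rb].
    have fr : is_derive r 1 f (df r) by apply: fD; rewrite r0.
    have id1 c := is_derive_scale c _ _ _ (is_derive_var r).
    exact: is_derive_sub (is_derive_scale s _ _ _
      (is_derive_sub _ _ _ _ _ fr (id1 m))) (id1 e).
  move=> r /andP[r0]; rewrite lt_min => /andP[rd rb].
  rewrite !mulr1 subr_le0 (le_trans (ler_norm _))// normrM s1 mul1r distrC dP//.
  by rewrite r0.
near=> h; have h0 : 0 < h by near: h; exact: nbhs_right_gt.
have hdb : 0 < h < Num.min d b.
  by rewrite h0 /=; near: h; apply: nbhs_right_lt; rewrite lt_min d0.
have h1 := bnd 1 (normr1 _) h hdb; have h2 := bnd (-1) _ h hdb.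
rewrite normrN1 in h2; have {}h2 := h2 erefl.
have -> : m - (f h - l) / h = (m * h - (f h - l)) / h.
  by field; rewrite gt_eqF.
rewrite normrM normfV (gtr0_norm h0) ler_pdivrMr// ler_norml.
by apply/andP; split; lra.
Unshelve. all: by end_near. Qed.

Section RadialSolution.
Context {R : realType} (N : nat) (p : R).
Hypotheses (N3 : (3 <= N)%N) (p1 : 1 < p).
Implicit Types (xi b r x y : R) (u W v : R -> R).

Let f := nonlin p.
Let k := N.-1.

Let k0 : (0 < k)%N. Proof. by rewrite /k; case: N N3 => [//|[]]. Qed.

Let kE : N%:R - 1 = k%:R :> R.
Proof. by rewrite /k; case: N N3 => // n _; rewrite -natr1 addrK. Qed.

Lemma nonlin_locally_lipschitz (M : R) : 0 <= M -> exists2 L, 0 <= L &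
  forall s t, `|s| <= M -> `|t| <= M -> `|f s - f t| <= L * `|s - t|.
Proof.
move=> M0; exists (p * M `^ (p - 1)); last exact: nonlin_lipschitz.
by rewrite mulr_ge0 ?powR_ge0// ltW// (lt_trans _ p1).
Qed.

Lemma cauchy_solution_picard xi b T u : cauchy_solution N p xi T u ->
  (b%:E <= T)%E -> picard_step k f xi b u u (radial_flux u).
Proof.
move=> [T0 u0 uq du0 uP] bT; split.
- have : (u h - u 0) / h * h + u 0 @[h --> 0^'+] --> 0 * 0 + u 0.
    apply: cvgD; last exact: cvg_cst.
    apply: cvgM => //; exact/cvg_at_right_filter/cvg_id.
  rewrite mulr0 add0r u0; apply: cvg_trans; apply: near_eq_cvg; near=> h.
  rewrite divfK ?subrK// gt_eqF//; near: h; exact: nbhs_right_gt.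
- have q : Num.sqrt (1 - derive1 u h ^+ 2) @[h --> 0^'+] --> Num.sqrt (1 - 0 ^+ 2 : R).
    apply: (continuous_cvg _ (@sqrt_continuous R _)).
    apply: cvgB; first exact: cvg_cst.
    exact: (continuous_cvg _ (@exprn_continuous R 2 _)).
  rewrite expr0n subr0 sqrtr1 in q.
  rewrite -[X in _ --> X](divr1 0); apply: cvgM => //.
  by apply: cvgV => //; exact: oner_neq0.
- move=> r /andP[r0 rb].
  have rT : (r%:E < T)%E by apply: lt_le_trans bT; rewrite lte_fin.
  have [d1 d2 _ v1 eq] := uP r r0 rT.
  split.
    have e : mcurv (radial_flux u r) = derive1 u r := mcurv_flux _ v1.
    by rewrite e; apply: (is_derive_eq (derivableP d1)); rewrite -derive1E.
  have v0 : 0 < 1 - derive1 u r ^+ 2.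
    by rewrite subr_gt0 -real_normK ?num_real// expr_lt1.
  have s0 : Num.sqrt (1 - derive1 u r ^+ 2) != 0 by rewrite gt_eqF ?sqrtr_gt0.
  have vD := derivableP d2.
  (* The chain and quotient rules serve for derivability of the flux; the value of its derivative is
     read off the equation. *)
  have sD := is_derive_comp Num.sqrt (fun r => 1 - derive1 u r ^+ 2) r _ _
    (is_derive1_sqrt v0) (is_derive_sub _ _ _ _ _ (is_derive_const 1 r)
       (is_derive_comp (fun y => y ^+ 2) _ _ _ _ (is_derive_pow 2 _) vD)).
  have fD := is_derive_mul _ _ _ _ _ vD (is_derive_inv
    (fun r => Num.sqrt (1 - derive1 u r ^+ 2)) _ _ s0 sD).
  have fd : derivable (radial_flux u) r 1 by case: fD.
  apply: (is_derive_eq (derivableP fd)).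
  rewrite -derive1E -kE; apply/eqP.
  by rewrite -opprD -addr_eq0 addrA eq.
Unshelve. all: by end_near. Qed.

Section Global.
Variables (xi : R) (u W : R -> R).
Hypothesis uW : forall b, picard_step k f xi b u u W.

Let rb1 r : 0 < r -> 0 < r < r + 1. Proof. by rewrite ltrDl ltr01 andbT. Qed.

Lemma global_derive_u r : 0 < r -> is_derive r 1 u (mcurv (W r)).
Proof. by move=> r0; have [_ _ /(_ r (rb1 r r0))[]] := uW (r + 1). Qed.

Lemma global_derive_W r : 0 < r ->
  is_derive r 1 W (- (k%:R / r * W r) - f (u r)).
Proof. by move=> r0; have [_ _ /(_ r (rb1 r r0))[]] := uW (r + 1). Qed.

Lemma global_derive1_u r : 0 < r -> derive1 u r = mcurv (W r).
Proof. by move=> r0; rewrite derive1E; have [_ ->] := global_derive_u r r0. Qed.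

Lemma global_flux r : 0 < r -> radial_flux u r = W r.
Proof. by move=> r0; rewrite /radial_flux global_derive1_u// mcurvK. Qed.

Definition second_derivative r : R :=
  ((1 + W r ^+ 2) * Num.sqrt (1 + W r ^+ 2))^-1
    * (- (k%:R / r * W r) - f (u r)).

Lemma global_derive_derive1_u r : 0 < r ->
  is_derive r 1 (derive1 u) (second_derivative r).
Proof.
move=> r0; have := is_derive_comp mcurv W r _ _ (is_derive_mcurv _)
  (global_derive_W r r0).
apply: near_eq_is_derive; near=> z; rewrite global_derive1_u//.
by near: z; exact: lt_nbhsr.
Unshelve. all: by end_near. Qed.

Lemma continuous_inv_curvature :
  continuous (fun w : R => ((1 + w ^+ 2) * Num.sqrt (1 + w ^+ 2))^-1).
Proof.
move=> w.
have c : (fun w : R => 1 + w ^+ 2) @ w --> 1 + w ^+ 2.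
  by apply: cvgD; [exact: cvg_cst|exact: exprn_continuous].
apply: cvgV; last exact: cvgM c (continuous_cvg _ (@sqrt_continuous R _) c).
by rewrite mulf_neq0// gt_eqF ?sqr1D_gt0 ?sqrt1D_gt0.
Qed.

Lemma continuous_second_derivative r : 0 < r ->
  {for r, continuous second_derivative}.
Proof.
move=> r0.
have cu : u @ r --> u r by exact: is_derive_continuous (global_derive_u r r0).
have cW : W @ r --> W r by exact: is_derive_continuous (global_derive_W r r0).
apply: cvgM; first exact: (continuous_cvg _ (continuous_inv_curvature _) cW).
apply: cvgB; last exact: (continuous_cvg _ (continuous_nonlin _ p1 _) cu).
apply: cvgN; apply: cvgM => //; apply: cvgM; first exact: cvg_cst.
by apply: cvgV; [rewrite gt_eqF|exact: cvg_id].
Qed.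

Lemma global_cauchy_solution : u 0 = xi -> cauchy_solution N p xi +oo%E u.
Proof.
move=> u0; have [uxi W0 _] := uW 1.
have mW0 : mcurv (W h) @[h --> 0^'+] --> (0 : R).
  by rewrite -[X in _ --> X](mcurv0 (R := R));
    exact: (continuous_cvg _ (continuous_mcurv 0) W0).
split => //.
- rewrite u0; apply: (right_derivative_limit u (fun r => mcurv (W r)) 1) => //.
  by move=> r /andP[r0 _]; exact: global_derive_u.
- apply: cvg_trans mW0; apply: near_eq_cvg; near=> h.
  rewrite global_derive1_u//; near: h; exact: nbhs_right_gt.
- move=> r r0 _; split.
  + by case: (global_derive_u r r0).
  + by case: (global_derive_derive1_u r r0).
  + have e z : 0 < z -> derive1n 2 u z = second_derivative z.
      by move=> z0; rewrite /= derive1E; have [_ ->] := global_derive_derive1_u z z0.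
    rewrite /continuous_at (e r r0).
    apply: cvg_trans (continuous_second_derivative r r0).
    apply: near_eq_cvg; near=> z; rewrite e//; near: z; exact: lt_nbhsr.
  + by rewrite global_derive1_u// mcurv_lt1.
  + have : is_derive r 1 (radial_flux u) (- (k%:R / r * W r) - f (u r)).
      have := global_derive_W r r0; apply: near_eq_is_derive.
      near=> z; rewrite global_flux//; near: z; exact: lt_nbhsr.
    move=> [_ dE]; rewrite derive1E dE global_flux// kE /f; ring.
Unshelve. all: by end_near. Qed.

End Global.

(** The global fixed point [v] agrees with [u] on [0, T[ by uniqueness, so a finite [T] would
    contradict maximality. *)
Lemma maximal_solution_global xi T u : maximal_cauchy_solution N p xi T u ->
  T = +oo%E.
Proof.
move=> [us um]; have [T0 u0 _ _ _] := us.
have [[v W] [/= vW v0 _]] := picard_fixpoint_exists k f k0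
  nonlin_locally_lipschitz (continuous_nonlin p p1) xi.
apply/eqP; apply: contraT => Too; exfalso.
have Tlt : (T < +oo)%E by rewrite ltey.
have vs := global_cauchy_solution xi v W vW (v0 0 (lexx _)).
apply: (um _ _ Tlt vs) => r r0 rT.
have [->|rN0] := eqVneq r 0; first by rewrite v0// u0.
have rp : 0 < r by rewrite lt0r rN0.
case: T T0 us um Too Tlt rT => [t||] // T0 us um _ _ rT.
have st := cauchy_solution_picard xi t _ u us (lexx _).
apply: (picard_fixpoint_unique k f k0 nonlin_locally_lipschitz
  xi t v W u _ (vW t) st).
by rewrite rp -lte_fin.
Qed.

End RadialSolution.

(** * Energy decay and sign changes *)

Section Asymptotics.
Context {R : realType} (N : nat) (p xi : R) (u W : R -> R).
Implicit Types (r s e x c d : R).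
Hypotheses (N3 : (3 <= N)%N) (p1 : 1 < p).

Let k := N.-1.

Hypothesis uW : forall b, picard_step k (nonlin p) xi b u u W.

Let k2 : 2 <= k%:R :> R.
Proof. by rewrite ler_nat /k; case: N N3. Qed.

Definition energy (r : R) : R :=
  Num.sqrt (1 + W r ^+ 2) - 1 + nonlin p (u r) * u r / (p + 1).

Let p10 : 0 < p + 1. Proof. by move: p1; lra. Qed.

(** The kinetic part has derivative [mcurv] in W, that is u', and the potential part has derivative
    f in u: the two terms f(u) u' cancel and only friction remains. *)
Lemma is_derive_energy r : 0 < r ->
  is_derive r 1 energy (- (k%:R / r * (W r * mcurv (W r)))).
Proof.
move=> r0.
have h1 := is_derive_comp _ W r _ _ (is_derive_sqrt1D (W r))
  (global_derive_W N p xi u W uW r r0).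
have h2 := is_derive_comp _ u r _ _ (is_derive_potential p p1 (u r))
  (global_derive_u N p xi u W uW r r0).
have h3 := is_derive_add _ _ _ _ _ (is_derive_sub _ _ _ _ _ h1
  (is_derive_const 1 r)) h2.
by apply: (is_derive_eq h3); rewrite /k; ring.
Qed.

Lemma mulr_mcurv_ge0 (w : R) : 0 <= w * mcurv w.
Proof. by rewrite /mcurv mulrA -expr2 divr_ge0 ?sqr_ge0 ?sqrtr_ge0. Qed.

Lemma sqrt1D_ge1 (w : R) : 1 <= Num.sqrt (1 + w ^+ 2).
Proof.
by rewrite -[leLHS]sqrtr1 ler_sqrt ?lerDl ?sqr_ge0// ltW// sqr1D_gt0.
Qed.

(** With q = sqrt (1 + w^2) >= 1, the claim is q - 1 <= (q^2 - 1) / q. *)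
Lemma sqrt1D_le_mcurv (w : R) : Num.sqrt (1 + w ^+ 2) - 1 <= w * mcurv w.
Proof.
rewrite /mcurv mulrA ler_pdivlMr ?sqrt1D_gt0//.
have := sqrt1D_sqr w; have := sqrt1D_ge1 w; set q := Num.sqrt _; nra.
Qed.

Lemma energy_ge0 r : 0 <= energy r.
Proof.
by rewrite addr_ge0 ?subr_ge0 ?sqrt1D_ge1// divr_ge0 ?nonlin_mul_ge0// ltW.
Qed.

Lemma energy_le r s : 0 < r -> r <= s -> energy s <= energy r.
Proof.
move=> r0 rs; rewrite -subr_le0.
have [|c /andP[rc _] ->] := mean_value energy
  (fun x => - (k%:R / x * (W x * mcurv (W x)))) r s rs.
  by move=> x /andP[rx _]; apply: is_derive_energy; exact: lt_le_trans rx.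
rewrite mulr_le0_ge0 ?subr_ge0// oppr_le0 mulr_ge0 ?mulr_mcurv_ge0//.
by rewrite divr_ge0// ltW// (lt_le_trans r0).
Qed.

Lemma energy_le_dissipation r :
  energy r <= W r * mcurv (W r) + nonlin p (u r) * u r.
Proof.
rewrite lerD ?sqrt1D_le_mcurv// ler_pdivrMr// ler_peMr ?nonlin_mul_ge0//.
by move: p1; lra.
Qed.

Lemma global_bounded : exists2 A, 0 <= A &
  forall r, 1 <= r -> `|W r| <= A /\ `|u r| <= A.
Proof.
have E0 := energy_ge0 1.
(* The kinetic part gives |W| <= 1 + E(1). The potential part gives |u|^(p + 1) <= (p + 1) E(1),
   which bounds |u| wherever |u| > 1; the summand 1 covers the remaining case. *)
exists (1 + (p + 1) * energy 1); first by rewrite addr_ge0// mulr_ge0// ltW.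
move=> r r1; have E1 := energy_le 1 r ltr01 r1.
have s1 := sqrt1D_ge1 (W r); have g0 := nonlin_mul_ge0 p (u r).
have gp : 0 <= nonlin p (u r) * u r / (p + 1) by rewrite divr_ge0// ltW.
have pE : energy 1 <= (p + 1) * energy 1 by rewrite ler_peMl//; move: p1; lra.
split.
  apply: (@le_trans _ _ (Num.sqrt (1 + W r ^+ 2))).
    by rewrite -sqrtr_sqr ler_sqrt ?lerDr// ltW// sqr1D_gt0.
  by move: E1; rewrite {1}/energy; lra.
have gE : nonlin p (u r) * u r <= (p + 1) * energy 1.
  rewrite -ler_pdivrMl// [leLHS]mulrC.
  by move: E1; rewrite {1}/energy; lra.
have [u1|u1] := leP `|u r| 1; first by move: gE g0; lra.
apply: (@le_trans _ _ ((p + 1) * energy 1)); last by lra.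
apply: le_trans gE; rewrite /nonlin -mulrA -expr2 -[u r ^+ 2]real_normK ?num_real//.
rewrite expr2 mulrA ler_peMl// mulr_ege1 ?(ltW u1)//.
by rewrite -[leLHS](powRr0 `|u r|) ler_powR ?(ltW u1)// subr_ge0 ltW.
Qed.

(* [energy + W u / r] decreases like [- e ln r] if the energy stays above [e]:
   this is the Pohozaev-type term that captures the oscillations. *)
Lemma energy_small e : 0 < e -> exists2 r, 1 <= r & energy r < e.
Proof.
move=> e0; apply: contrapT => nex.
have Ee r : 1 <= r -> e <= energy r.
  by move=> r1; rewrite leNgt; apply/negP => h; apply: nex; exists r.
have [A A0 AP] := global_bounded.
(* The derivative of W u / r leaves a remainder - (k + 1) W u / r^2; the term K / r of [Phi]
   compensates it. *)
pose K := (k%:R + 1) * (A * A).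
have K0 : 0 <= K by rewrite mulr_ge0 ?mulr_ge0// addr_ge0.
pose Phi r := energy r + W r * u r * r^-1 + e * ln r + K * r^-1.
have PhiD r : 1 <= r -> exists2 d, is_derive r 1 Phi d & d <= 0.
  move=> r1; have r0 : 0 < r by exact: lt_le_trans r1.
  have rN0 : r != 0 by rewrite gt_eqF.
  have hV := is_derive_inv (fun r => r) _ _ rN0 (is_derive_var r).
  have hW := global_derive_W N p xi u W uW r r0.
  have hu := global_derive_u N p xi u W uW r r0.
  have h := is_derive_add _ _ _ _ _ (is_derive_add _ _ _ _ _
    (is_derive_add _ _ _ _ _ (is_derive_energy r r0)
      (is_derive_mul _ _ _ _ _ (is_derive_mul _ _ _ _ _ hW hu) hV))
    (is_derive_scale e _ _ _ (is_derive1_ln r0))) (is_derive_scale K _ _ _ hV).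
  eexists; first exact: h.
  have [Wr ur] := AP r r1.
  have WuA : - (W r * u r) <= A * A.
    by rewrite (le_trans (ler_norm _))// normrN normrM ler_pM.
  have Er := le_trans (Ee r r1) (energy_le_dissipation r).
  have P0 := mulr_mcurv_ge0 (W r).
  set P := W r * mcurv (W r) in Er P0 *.
  set G := nonlin p (u r) * u r in Er.
  have kr : - (k%:R + 1) * (W r * u r) <= K by rewrite mulNr -mulrN ler_wpM2l// addr_ge0.
  (* Here N >= 3 enters: k - 1 >= 1, so (k - 1) P + G still dominates the energy. *)
  have kP : P <= (k%:R - 1) * P by rewrite ler_peMl//; move: k2; lra.
  suff : r ^+ 2 * (- (k%:R / r * P) + ((- (k%:R / r * W r) - nonlin p (u r)) * u r
    + W r * mcurv (W r)) * r^-1 + W r * u r * (- 1 / r ^+ 2) + e * r^-1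
    + K * (- 1 / r ^+ 2)) <= 0.
    rewrite pmulr_rle0 ?exprn_gt0//; apply: le_trans.
    by rewrite le_eqVlt; apply/orP; left; apply/eqP; rewrite /P /k; ring.
  have -> : r ^+ 2 * (- (k%:R / r * P) + ((- (k%:R / r * W r) - nonlin p (u r)) * u r
    + W r * mcurv (W r)) * r^-1 + W r * u r * (- 1 / r ^+ 2) + e * r^-1
    + K * (- 1 / r ^+ 2)) =
      r * (e - ((k%:R - 1) * P + G)) + (- (k%:R + 1) * (W r * u r) - K).
    by rewrite /P /G; field.
  suff : r * (e - ((k%:R - 1) * P + G)) <= 0 by lra.
  by rewrite pmulr_rle0//; lra.
have Phi_le r : 1 <= r -> Phi r <= Phi 1.
  move=> r1; rewrite -subr_le0.
  pose d x := derive1 Phi x.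
  have [x /andP[x1 _]|c /andP[c1 _] ->] := mean_value Phi d 1 r r1.
    have [dx h _] := PhiD x x1; apply: (is_derive_eq h).
    by rewrite /d derive1E; case: h.
  have [dx h dx0] := PhiD c c1; rewrite mulr_le0_ge0 ?subr_ge0//.
  by rewrite /d derive1E; case: h => _ ->.
have lnB r : 1 <= r -> e * ln r <= Phi 1 + A * A.
  move=> r1; have := Phi_le r r1; rewrite {1}/Phi.
  have r0 : 0 < r by exact: lt_le_trans r1.
  have [Wr ur] := AP r r1; have := energy_ge0 r.
  have : 0 <= K * r^-1 by rewrite mulr_ge0// invr_ge0 ltW.
  have : - (W r * u r * r^-1) <= A * A.
    rewrite (le_trans (ler_norm _))// normrN normrM normrM normfV (gtr0_norm r0).
    rewrite ler_pdivrMr// (@le_trans _ _ (A * A))//; first by rewrite ler_pM.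
    by rewrite ler_peMr// mulr_ge0.
  lra.
have B0 : 0 <= Phi 1 + A * A by have := lnB 1 (lexx _); rewrite ln1 mulr0.
(* At this radius [e * ln r] exceeds its bound by exactly [e]. *)
have r1 : 1 <= expR ((Phi 1 + A * A) / e + 1).
  by rewrite -[leLHS]expR0 ler_expR addr_ge0// divr_ge0// ltW.
have := lnB _ r1; rewrite expRK mulrDr mulrCA divff ?gt_eqF// !mulr1.
by rewrite gerDl leNgt e0.
Qed.

Lemma global_vanishes : u r @[r --> +oo] --> (0 : R).
Proof.
apply/cvgrPdist_le => e e0.
(* The threshold is the potential energy at |u| = e. *)
have [|r1 r11 Er1] := energy_small (e `^ (p - 1) * e ^+ 2 / (p + 1)).
  by rewrite divr_gt0// mulr_gt0 ?powR_gt0// exprn_gt0.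
near=> r; have r1r : r1 <= r by near: r; apply: nbhs_pinfty_ge; exact: num_real.
rewrite sub0r normrN leNgt; apply/negP => eu.
have := le_lt_trans (energy_le r1 r (lt_le_trans ltr01 r11) r1r) Er1.
apply/negP; rewrite -leNgt.
apply: (@le_trans _ _ (nonlin p (u r) * u r / (p + 1))); last first.
  by rewrite lerDr subr_ge0 sqrt1D_ge1.
rewrite ler_pM2r ?invr_gt0// /nonlin -mulrA -expr2 -[u r ^+ 2]real_normK ?num_real//.
rewrite ler_pM ?powR_ge0 ?exprn_ge0 ?(ltW e0)//.
  by rewrite ge0_ler_powR ?nnegrE ?(ltW e0) ?(ltW eu)// subr_ge0 ltW.
by rewrite lerXn2r ?nnegrE ?(ltW e0) ?(ltW eu).
Unshelve. all: by end_near. Qed.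

(* Up to [r = xi / 2] the solution exceeds [xi / 2], so the flux at [xi / 4] is
   at most [- xi / (4 N)]; then [r ^+ k * W r] decreases as long as [u >= 0],
   which keeps [W <= -1] and [u' <= - 1 / 2] up to [r = 4 xi]. *)
Lemma global_takes_negative : 2 <= xi -> 4 * N%:R * 16 ^+ k <= xi ->
  exists2 r, 0 < r & u r < 0.
Proof.
move=> xi2 xiN; apply: contrapT => nex.
have u0 r : 0 < r -> 0 <= u r.
  by move=> r0; rewrite leNgt; apply/negP => h; apply: nex; exists r.
have NE : N%:R = k%:R + 1 :> R by rewrite /k natr1; case: N N3.
have NR : 0 < N%:R :> R by rewrite ltr0n; case: N N3.
have xi0 : 0 < xi by apply: lt_le_trans xi2.
have dist r : 0 < r -> `|u r - xi| <= r.
  move=> r0; apply: (picard_step_dist0 k (nonlin p) xi (r + 1) u u W (uW _)).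
  by rewrite r0 ltrDl ltr01.
pose m := (xi / 2) `^ p.
have xi21 : 1 <= xi / 2 by rewrite ler_pdivlMr ?mul1r.
have m1 : 1 <= m.
  by apply: (le_trans xi21); rewrite /m le1r_powR// (ltW p1).
(* - (m / N) r is the exact solution of W' + k W / r = - m, as k + 1 = N, and f(u) >= m here. *)
have WD : forall r, 0 < r < xi / 2 -> W r + m / N%:R * r <= 0.
  have k0 : (0 < k)%N by rewrite /k; case: N N3 => [//|[]].
  apply: (radial_comparison k _ _
    (fun r => (- (k%:R / r * W r) - nonlin p (u r)) + m / N%:R * 1)
    (0 + m / N%:R * 0) k0) => [|r /andP[r0 rxi]|r /andP[r0 rxi]].
  - have [_ W0 _] := uW 1; apply: cvgD => //; apply: cvgM; first exact: cvg_cst.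
    exact/cvg_at_right_filter/cvg_id.
  - apply: is_derive_add (is_derive_scale _ _ _ _ (is_derive_var r)).
    exact: (global_derive_W N p xi u W uW).
  - have := dist r r0; rewrite ler_norml => /andP[ur _].
    have mu : m <= nonlin p (u r).
      rewrite nonlin_ge0 ?u0// ge0_ler_powR ?nnegrE ?u0//.
      + by rewrite ltW// (lt_trans _ p1).
      + by rewrite ltW// divr_gt0.
      + lra.
    have -> : - (k%:R / r * W r) - nonlin p (u r) + m / N%:R * 1
        + k%:R / r * (W r + m / N%:R * r) = m - nonlin p (u r).
      by rewrite NE; field; rewrite gt_eqF//= gt_eqF// -NE.
    by rewrite subr_le0.
have W4 : W (xi / 4) <= - 16 ^+ k.
  have := WD (xi / 4) _ => /(_ _)/le_trans.
  have q : 16 ^+ k <= m / N%:R * (xi / 4).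
    have -> : m / N%:R * (xi / 4) = m * (xi / (4 * N%:R)).
      by field; rewrite gt_eqF.
    rewrite -[leLHS]mul1r ler_pM// ?exprn_ge0//.
    by rewrite ler_pdivlMr ?mulr_gt0// mulrC.
  have xi4 : 0 < xi / 4 < xi / 2 by apply/andP; split; lra.
  have := WD _ xi4; lra.
(* 16 is the ratio of the end radii, so [r ^+ k] grows by a factor at most [16 ^+ k] and a flux
   below [- 16 ^+ k] at the start stays below -1. *)
have W1 r : xi / 4 <= r <= 4 * xi -> W r <= -1.
  move=> /andP[r4 r4x].
  have x40 : 0 < xi / 4 by rewrite divr_gt0.
  have r0 : 0 < r by exact: lt_le_trans r4.
  have [|c /andP[c4 _]] := mean_value (fun r => r ^+ k * W r)
    (fun r => - (r ^+ k * nonlin p (u r))) (xi / 4) r r4.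
    move=> x /andP[x4 _]; have x0 : 0 < x by exact: lt_le_trans x4.
    have h := is_derive_mul _ _ _ _ _ (is_derive_pow k x)
      (global_derive_W N p xi u W uW x x0).
    apply: (is_derive_eq h); have xN0 : x != 0 by rewrite gt_eqF.
    have kS : k = k.-1.+1 by rewrite /k; case: N N3 => [//|[]].
    rewrite -/k [in x ^+ k]kS [in RHS]kS exprS; field.
    by [].
  have c0 : 0 < c by exact: lt_le_trans c4.
  have : - (c ^+ k * nonlin p (u c)) * (r - xi / 4) <= 0.
    rewrite mulr_le0_ge0 ?subr_ge0// oppr_le0 mulr_ge0 ?exprn_ge0 ?(ltW c0)//.
    by rewrite nonlin_ge0 ?u0// powR_ge0.
  move=> /[swap] <-; rewrite subr_le0 => rW.
  have rk : 0 < r ^+ k by rewrite exprn_gt0.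
  rewrite -(ler_pM2l rk); apply: (le_trans rW).
  apply: (@le_trans _ _ ((xi / 4) ^+ k * - 16 ^+ k)).
    by rewrite ler_pM2l ?exprn_gt0.
  rewrite mulrN mulrN1 lerN2 -exprMn lerXn2r ?nnegrE ?(ltW r0)//; last by lra.
  by rewrite mulr_ge0// ltW.
have x44 : xi / 4 <= 4 * xi by lra.
(* A slope at most -1/2 over a length 15 xi / 4 lowers [u] by at least 15 xi / 8, while it starts
   from at most 5 xi / 4. *)
have [|c cx] := mean_value u (fun r => mcurv (W r)) _ _ x44.
  move=> x /andP[x4 _]; apply: (global_derive_u N p xi u W uW).
  by apply: lt_le_trans x4; rewrite divr_gt0.
have mc := mcurv_le_half _ (W1 c cx).
have := dist (xi / 4); rewrite divr_gt0// => /(_ erefl).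
rewrite ler_norml => /andP[_ u4] uE.
have : mcurv (W c) * (4 * xi - xi / 4) <= - 2^-1 * (4 * xi - xi / 4).
  by rewrite ler_wpM2r//; lra.
have := u0 (4 * xi); rewrite mulr_gt0// => /(_ erefl); lra.
Qed.

End Asymptotics.

(** * Radial functions on the Euclidean space *)

Section RadialFields.
Context {R : realType} {N : nat}.
Implicit Types (x y : 'rV[R]_N) (i j : 'I_N) (g dg : R -> R) (r h : R).

Lemma enorm_ge0 x : 0 <= enorm x. Proof. exact: sqrtr_ge0. Qed.

Lemma enorm_sqr x : enorm x ^+ 2 = \sum_i x 0 i ^+ 2.
Proof. by rewrite sqr_sqrtr// sumr_ge0// => i _; rewrite sqr_ge0. Qed.

Lemma enorm0 : enorm (0 : 'rV[R]_N) = 0.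
Proof. by rewrite /enorm big1 ?sqrtr0// => i _; rewrite mxE expr0n. Qed.

Lemma coord_le_enorm x i : `|x 0 i| <= enorm x.
Proof.
rewrite -sqrtr_sqr ler_sqrt; last by rewrite sumr_ge0// => j _; rewrite sqr_ge0.
by rewrite (bigD1 i)//= lerDl sumr_ge0// => j _; rewrite sqr_ge0.
Qed.

Lemma enorm_gt0 x : x != 0 -> 0 < enorm x.
Proof.
move=> x0; rewrite lt0r enorm_ge0 andbT; apply: contra_neq x0 => e0.
apply/rowP => i; rewrite mxE; apply/eqP.
by have := coord_le_enorm x i; rewrite e0 normr_le0.
Qed.

Lemma line_coord x i j h :
  (h *: delta_mx 0 j + x) 0 i = h * (i == j)%:R + x 0 i.
Proof. by rewrite !mxE eqxx. Qed.

Lemma enorm_line x j h :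
  enorm (h *: delta_mx 0 j + x) =
  Num.sqrt (enorm x ^+ 2 + (2 * x 0 j * h + h ^+ 2)).
Proof.
rewrite enorm_sqr /enorm; congr Num.sqrt.
rewrite (bigD1 j)//= [in RHS](bigD1 j)//= line_coord eqxx.
have -> : \sum_(i < N | i != j) (h *: delta_mx 0 j + x) 0 i ^+ 2 =
    \sum_(i < N | i != j) x 0 i ^+ 2.
  by apply: eq_bigr => i /negbTE ij; rewrite line_coord ij mulr0 add0r.
by rewrite mulr1; ring.
Qed.

Lemma enorm_axis j h : enorm (h *: delta_mx 0 j : 'rV[R]_N) = `|h|.
Proof.
rewrite -[_ *: _]addr0 enorm_line enorm0 mxE expr0n mulr0 mul0r !add0r.
exact: sqrtr_sqr.
Qed.

Lemma continuous_enorm : continuous (@enorm R N).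
Proof.
move=> x.
have c : continuous (fun x : 'rV[R]_N => \sum_i x 0 i ^+ 2).
  apply: continuous_big; first exact: add_continuous.
  move=> i _ y.
  exact: (continuous_cvg _ (@exprn_continuous R 2 _) (@coord_continuous R 1 N 0 i y)).
exact: (continuous_cvg _ (@sqrt_continuous R _) (c x)).
Qed.

Lemma is_derive_line (F : 'rV[R]_N -> R) x v d :
  is_derive (0 : R) 1 (fun h => F (h *: v + x)) d -> is_derive x v F d.
Proof.
have e : (fun h : R => h^-1 *: ((F \o shift x) (h *: v) - F x)) =
    (fun h : R => h^-1 *: (((fun h => F (h *: v + x)) \o shift 0) (h *: 1) -
      F (0 *: v + x))).
  by apply/funext => h /=; rewrite addr0 scale0r add0r [h *: 1]mulr1.
by case=> dF dE; apply: DeriveDef; rewrite /derivable /derive e.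
Qed.

Lemma continuous_radial g x : (forall r, 0 < r -> {for r, continuous g}) ->
    g h @[h --> 0^'+] --> g 0 ->
  (fun y => g (enorm y)) @ x --> g (enorm x).
Proof.
move=> gc g0; apply: continuous_nonneg_comp => //; first exact: enorm_ge0.
exact: continuous_enorm.
Qed.

Lemma is_derive_enorm_line x j : x != 0 ->
  is_derive (0 : R) 1 (fun h => enorm (h *: delta_mx 0 j + x)) (x 0 j / enorm x).
Proof.
move=> x0; under eq_fun do rewrite enorm_line.
have e0 := enorm_gt0 x x0.
have pos : 0 < enorm x ^+ 2 + (2 * x 0 j * 0 + 0 ^+ 2).
  by rewrite expr0n mulr0 !addr0 exprn_gt0.
have h := is_derive_comp Num.sqrt
  (fun h => enorm x ^+ 2 + (2 * x 0 j * h + h ^+ 2)) 0 _ _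
  (is_derive1_sqrt pos)
  (is_derive_add _ _ _ _ _ (is_derive_const _ _) (is_derive_add _ _ _ _ _
    (is_derive_scale (2 * x 0 j) _ _ _ (is_derive_var 0)) (is_derive_pow 2 0))).
apply: (is_derive_eq h).
rewrite expr0n mulr0 !addr0 add0r mulr1 sqrtr_sqr ger0_norm ?(ltW e0)//=.
by rewrite expr1 mulr0 addr0; field; rewrite gt_eqF.
Qed.

(** At the origin the function along the j-th axis is g(|h|) h when i = j and 0 otherwise, so
    continuity of [g] gives the derivative; the second term of the formula vanishes there through
    its factor [x 0 i * x 0 j]. *)
Lemma is_derive_radial_coord g dg x i j :
    (forall r, 0 < r -> is_derive r 1 g (dg r)) ->
    g h @[h --> 0^'+] --> g 0 ->
  is_derive x (delta_mx 0 j) (fun y => g (enorm y) * y 0 i)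
    (g (enorm x) * (i == j)%:R + dg (enorm x) / enorm x * (x 0 i * x 0 j)).
Proof.
move=> gD g0; apply: is_derive_line.
under eq_fun do rewrite line_coord.
have [->|x0] := eqVneq x 0.
  apply/is_derive1_caratheodory.
  exists (fun h => g `|h| * (i == j)%:R).
  split.
  - by move=> z; rewrite !mxE !addr0 enorm_axis; ring.
  - have gn : (fun h => g `|h|) @ (0 : R) --> g `|0 : R|.
      apply: continuous_nonneg_comp g0 _ _ => //; last exact: norm_continuous.
      by move=> r r0; exact: is_derive_continuous (gD r r0).
    by apply: cvgM gn _; exact: cvg_cst.
  - by rewrite normr0 enorm0 !mxE !mulr0 addr0.
have e0 := enorm_gt0 x x0; have eN0 : enorm x != 0 by rewrite gt_eqF.
have hx : enorm (0 *: delta_mx 0 j + x) = enorm x by rewrite scale0r add0r.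
have gDx : is_derive (enorm (0 *: delta_mx 0 j + x)) 1 g (dg (enorm x)).
  by rewrite hx; exact: gD.
have h1 := is_derive_comp g (fun h => enorm (h *: delta_mx 0 j + x)) 0 _ _ gDx
  (is_derive_enorm_line x j x0).
have h2 := is_derive_add _ _ _ _ _ (is_derive_mul _ _ _ _ _ (is_derive_var 0)
  (is_derive_const (i == j)%:R 0)) (is_derive_const (x 0 i) 0).
apply: (is_derive_eq (is_derive_mul _ _ _ _ _ h1 h2)).
by rewrite hx; field.
Qed.

Lemma is_derive_radial g dg x j :
    (forall r, 0 < r -> is_derive r 1 g (dg r)) ->
    (g h - g 0) / h @[h --> 0^'+] --> (0 : R) ->
  is_derive x (delta_mx 0 j) (fun y => g (enorm y))
    (dg (enorm x) / enorm x * x 0 j).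
Proof.
move=> gD g0; apply: is_derive_line.
have [->|x0] := eqVneq x 0.
  pose q r := (g r - g 0) / r.
  have q00 : q 0 = 0 by rewrite /q subrr mul0r.
  have qc : (fun h => q `|h|) @ (0 : R) --> (0 : R).
    rewrite -[X in _ --> X]q00 -{2}(normr0 R).
    apply: continuous_nonneg_comp => //; last exact: norm_continuous.
      move=> r r0; apply: cvgM.
        by apply: cvgB; [exact: is_derive_continuous (gD r r0)|exact: cvg_cst].
      by apply: cvgV; [rewrite gt_eqF|exact: cvg_id].
    by rewrite q00.
  (* The factor [|h| / h] is the sign of h, which is bounded, and [q] tends to 0. *)
  apply/is_derive1_caratheodory; exists (fun h => q `|h| * (`|h| / h)); split.
  - move=> z; rewrite !addr0 scale0r enorm0 enorm_axis subr0 /q.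
    have [->|z0] := eqVneq z 0; first by rewrite normr0 subrr !mulr0.
    by rewrite mulrA !divfK ?normr_eq0.
  - rewrite /prop_for /continuous_at normr0 q00 mul0r.
    apply: cvg0_dominated qc => z; rewrite normrM.
    rewrite -[leRHS]mulr1 ler_wpM2l//.
    have [->|z0] := eqVneq z 0; first by rewrite normr0 mul0r normr0.
    by rewrite normrM normfV normr_id divff ?normr_eq0.
  - by rewrite enorm0 !mxE normr0 q00 mul0r mulr0.
have hx : enorm (0 *: delta_mx 0 j + x) = enorm x by rewrite scale0r add0r.
have gDx : is_derive (enorm (0 *: delta_mx 0 j + x)) 1 g (dg (enorm x)).
  by rewrite hx; apply: gD; exact: enorm_gt0.
apply: (is_derive_eq (is_derive_comp g _ 0 _ _ gDx (is_derive_enorm_line x j x0))).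
by rewrite mulrCA mulrC.
Qed.

(** Continuity of the partial derivatives at 0 comes from |x_i x_j| <= |x|^2: the term with [dg] is
    dominated by |x| |dg(|x|)|, which the last hypothesis sends to 0. *)
Lemma classC1_radial_coord g dg i :
    (forall r, 0 < r -> is_derive r 1 g (dg r)) ->
    (forall r, 0 < r -> {for r, continuous dg}) ->
    g h @[h --> 0^'+] --> g 0 ->
    h * dg h @[h --> 0^'+] --> (0 : R) ->
  classC1 (fun y : 'rV[R]_N => g (enorm y) * y 0 i).
Proof.
move=> gD dgc g0 dg0.
have gc r : 0 < r -> {for r, continuous g}.
  by move=> r0; exact: is_derive_continuous (gD r r0).
have gec x : (fun y => g (enorm y)) @ x --> g (enorm x).
  exact: continuous_radial.
split.
  by move=> x; apply: cvgM (gec x) _; exact: coord_continuous.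
move=> j; split.
  by move=> x; case: (is_derive_radial_coord g dg x i j gD g0).
have -> : partial j (fun y : 'rV[R]_N => g (enorm y) * y 0 i) = fun x =>
    g (enorm x) * (i == j)%:R + dg (enorm x) / enorm x * (x 0 i * x 0 j).
  apply/funext => x; rewrite /partial.
  by case: (is_derive_radial_coord g dg x i j gD g0).
move=> x.
have c1 : (fun x => g (enorm x) * (i == j)%:R) @ x --> g (enorm x) * (i == j)%:R.
  exact: cvgM (gec x) (cvg_cst _).
suff c2 : (fun x => dg (enorm x) / enorm x * (x 0 i * x 0 j)) @ x -->
    dg (enorm x) / enorm x * (x 0 i * x 0 j) by exact: cvgD c1 c2.
have [->|x0] := eqVneq x 0.
  rewrite !mxE mul0r mulr0.
  pose chi r := r * dg r.
  have chic : (fun y => chi (enorm y)) @ (0 : 'rV[R]_N) --> chi (enorm (0 : 'rV[R]_N)).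
    apply: continuous_radial; last by rewrite /chi mul0r.
    by move=> r r0; apply: cvgM; [exact: cvg_id|exact: dgc].
  rewrite enorm0 {2}/chi mul0r in chic.
  apply: (@cvg0_dominated R 'rV[R]_N _ (fun y => chi (enorm y))) chic => y.
  have [->|y0] := eqVneq y 0; first by rewrite !mxE mul0r mulr0 normr0.
  have ey := enorm_gt0 y y0.
  rewrite /chi !normrM normfV (gtr0_norm ey) [leRHS]mulrC -mulrA ler_wpM2l//.
  rewrite mulrC ler_pdivrMr// ler_pM//; exact: coord_le_enorm.
have e0 := enorm_gt0 x x0.
have c3 : (fun y => dg (enorm y)) @ x --> dg (enorm x).
  exact: (continuous_cvg _ (dgc _ e0) (continuous_enorm x)).
have inv_c : {for enorm x, continuous (fun r : R => r^-1)}.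
  by apply: cvgV; [rewrite gt_eqF|exact: cvg_id].
have c4 : (fun y => (enorm y)^-1) @ x --> (enorm x)^-1.
  exact: (continuous_cvg _ inv_c (continuous_enorm x)).
have cc l := @coord_continuous R 1 N 0 l x.
exact: cvgM (cvgM c3 c4) (cvgM (cc i) (cc j)).
Qed.

End RadialFields.

(** * Functions of the radius divided by the radius *)

Section QuotientByRadius.
Context {R : realType} (w dw : R -> R) (l : R).
Hypothesis wD : forall r : R, 0 < r -> is_derive r 1 w (dw r).
Hypothesis wl : w h / h @[h --> 0^'+] --> l.
Implicit Types r : R.

(** Radial factor of the vector field w(|x|) x / |x|, completed by its limit at the origin. It is
    taken with w = u' for the gradient and w = W for the flux. *)
Definition radius_quotient r : R := if 0 < r then w r / r else l.

Definition radius_quotient_derivative r : R := (dw r - w r / r) / r.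

Lemma is_derive_radius_quotient r : 0 < r ->
  is_derive r 1 radius_quotient (radius_quotient_derivative r).
Proof.
move=> r0; have rN0 : r != 0 by rewrite gt_eqF.
have h := is_derive_mul _ _ _ _ _ (wD r r0)
  (is_derive_inv (fun r => r) _ _ rN0 (is_derive_var r)).
have {}h : is_derive r 1 (fun r => w r / r) (radius_quotient_derivative r).
  by apply: (is_derive_eq h); rewrite /radius_quotient_derivative; field.
move: h; apply: near_eq_is_derive; near=> z; rewrite /radius_quotient ifT//.
by near: z; exact: lt_nbhsr.
Unshelve. all: by end_near. Qed.

Lemma radius_quotient_limit :
  radius_quotient h @[h --> 0^'+] --> radius_quotient 0.
Proof.
rewrite {2}/radius_quotient ltxx; apply: cvg_trans wl; apply: near_eq_cvg.
near=> h; rewrite /radius_quotient ifT//; near: h; exact: nbhs_right_gt.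
Unshelve. all: by end_near. Qed.

Lemma continuous_radius_quotient_derivative r : 0 < r ->
  {for r, continuous dw} -> {for r, continuous radius_quotient_derivative}.
Proof.
move=> r0 dwc; have ic : {for r, continuous (fun r : R => r^-1)}.
  by apply: cvgV; [rewrite gt_eqF|exact: cvg_id].
have wc : {for r, continuous w} by exact: is_derive_continuous (wD r r0).
exact: cvgM (cvgB dwc (cvgM wc ic)) ic.
Qed.

(** r (w / r)' = w' - w / r, and both terms tend to [l]. *)
Lemma radius_quotient_derivative_limit : dw h @[h --> 0^'+] --> l ->
  h * radius_quotient_derivative h @[h --> 0^'+] --> (0 : R).
Proof.
move=> dwl; rewrite -[X in _ --> X](subrr l).
apply: cvg_trans (cvgB dwl wl); apply: near_eq_cvg; near=> h.
have h0 : 0 < h by near: h; exact: nbhs_right_gt.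
by rewrite /radius_quotient_derivative [RHS]mulrC divfK// gt_eqF.
Unshelve. all: by end_near. Qed.

End QuotientByRadius.

(** * From the radial equation to the equation in space *)

Section RadialPDE.
Context {R : realType} (N : nat) (p xi : R) (u W : R -> R).
Hypotheses (N3 : (3 <= N)%N) (p1 : 1 < p).

Let k := N.-1.
Let f := nonlin p.

Hypothesis uW : forall b, picard_step k f xi b u u W.
Hypothesis u0 : u 0 = xi.
Implicit Types (x y : 'rV[R]_N) (i j : 'I_N) (r : R).

Let k0 : (0 < k)%N. Proof. by rewrite /k; case: N N3 => [//|[]]. Qed.

Let NE : N%:R = k%:R + 1 :> R.
Proof. by rewrite /k natr1; case: N N3. Qed.

Let N0 : 0 < N%:R :> R. Proof. by rewrite ltr0n; case: N N3. Qed.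

(* The common value at 0 of [W / r], [W'] and [u'']. *)
Let l : R := - (f xi / N%:R).

Let kl : - (k%:R * l) - f xi = l.
Proof. by rewrite /l NE; field; rewrite -NE gt_eqF. Qed.

Let u_lim : u h @[h --> 0^'+] --> xi. Proof. by have [] := uW 1. Qed.

Let fu_lim : f (u h) @[h --> 0^'+] --> f xi.
Proof. exact: (continuous_cvg _ (continuous_nonlin _ p1 _) u_lim). Qed.

Let W_lim : W h @[h --> 0^'+] --> (0 : R). Proof. by have [] := uW 1. Qed.

Let duD r : 0 < r -> is_derive r 1 u (mcurv (W r)).
Proof. exact: (global_derive_u N p xi u W uW). Qed.

Let dW r : R := - (k%:R / r * W r) - f (u r).

Let dWD r : 0 < r -> is_derive r 1 W (dW r).
Proof. exact: (global_derive_W N p xi u W uW). Qed.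

(** W is compared with (l + e) r and (l - e) r. By the choice of [l], the equation for W - l r has
    right-hand side f(xi) - f(u), which is at most e <= N e in absolute value near 0. *)
Lemma flux_quotient_limit : W h / h @[h --> 0^'+] --> l.
Proof.
apply/cvgrPdist_le => e e0.
have [d d0 dP] : exists2 d, 0 < d & forall r, 0 < r < d -> `|f xi - f (u r)| <= e.
  have /cvgrPdist_le/(_ e e0) := fu_lim.
  rewrite /at_right near_withinE => /nbhs_ballP[d /= d0 dP].
  exists d => // r /andP[r0 rd]; apply: dP => //.
  by rewrite /ball /= sub0r normrN gtr0_norm.
have bnd (s : R) : `|s| = 1 -> forall r, 0 < r < d -> s * (W r - l * r) - e * r <= 0.
  move=> s1; apply: (radial_comparison k d _
    (fun r => s * (dW r - l * 1) - e * 1) (s * (0 - l * 0) - e * 0) k0).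
  - have idl : (h : R) @[h --> 0^'+] --> (0 : R).
      exact/cvg_at_right_filter/cvg_id.
    have cl (c : R) : c * h @[h --> 0^'+] --> c * 0 by exact: cvgM (cvg_cst _) idl.
    exact: cvgB (cvgM (cvg_cst _) (cvgB W_lim (cl l))) (cl e).
  - move=> r /andP[r0 _].
    have id1 c := is_derive_scale c _ _ _ (is_derive_var r).
    exact: is_derive_sub (is_derive_scale s _ _ _
      (is_derive_sub _ _ _ _ _ (dWD r r0) (id1 l))) (id1 e).
  - move=> r rd; have r0 : r != 0 by rewrite gt_eqF//; case/andP: rd.
    have -> : s * (dW r - l * 1) - e * 1 + k%:R / r * (s * (W r - l * r) - e * r)
        = s * (- (k%:R * l) - l - f (u r)) - N%:R * e.
      by rewrite /dW NE; field.
    have -> : - (k%:R * l) - l = f xi by move: kl; lra.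
    rewrite subr_le0 (le_trans (ler_norm _))// normrM s1 mul1r.
    by rewrite (le_trans (dP r rd))// ler_peMl ?(ltW e0)// ler1n; case: N N3.
near=> h; have h0 : 0 < h by near: h; exact: nbhs_right_gt.
have hd : 0 < h < d by rewrite h0 /=; near: h; exact: nbhs_right_lt.
have h1 := bnd 1 (normr1 _) h hd; have h2 := bnd (-1) _ h hd.
rewrite normrN1 in h2; have {}h2 := h2 erefl.
have -> : l - W h / h = (l * h - W h) / h by field; rewrite gt_eqF.
rewrite normrM normfV (gtr0_norm h0) ler_pdivrMr// ler_norml.
by apply/andP; split; lra.
Unshelve. all: by end_near. Qed.

Lemma flux_derivative_limit : dW h @[h --> 0^'+] --> l.
Proof.
rewrite -kl.
have h : (fun h => - (k%:R * (W h / h)) - f (u h)) @ 0^'+ --> - (k%:R * l) - f xi.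
  exact: cvgB (cvgN (cvgM (cvg_cst _) flux_quotient_limit)) fu_lim.
apply: cvg_trans h; apply: near_eq_cvg; near=> h.
by rewrite /dW /= mulrAC mulrA.
Unshelve. all: by end_near. Qed.

Lemma curvature_limit :
  ((1 + W h ^+ 2) * Num.sqrt (1 + W h ^+ 2))^-1 @[h --> 0^'+] --> (1 : R).
Proof.
have c : ((1 + W h ^+ 2) * Num.sqrt (1 + W h ^+ 2))^-1 @[h --> 0^'+] -->
    ((1 + 0 ^+ 2) * Num.sqrt (1 + 0 ^+ 2) : R)^-1.
  exact: (continuous_cvg _ (continuous_inv_curvature (R := R) 0) W_lim).
by rewrite expr0n addr0 sqrtr1 mulr1 invr1 in c.
Qed.

Let ddu := second_derivative N p u W.

Lemma second_derivative_limit : ddu h @[h --> 0^'+] --> l.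
Proof. by rewrite -(mul1r l); exact: cvgM curvature_limit flux_derivative_limit. Qed.

Lemma slope_quotient_limit : mcurv (W h) / h @[h --> 0^'+] --> l.
Proof.
have s : (Num.sqrt (1 + W h ^+ 2))^-1 @[h --> 0^'+] --> (1 : R).
  have c : {for 0, continuous (fun w : R => (Num.sqrt (1 + w ^+ 2))^-1)}.
    apply: cvgV; first by rewrite gt_eqF ?sqrt1D_gt0.
    exact: is_derive_continuous (is_derive_sqrt1D 0).
  have s : (Num.sqrt (1 + W h ^+ 2))^-1 @[h --> 0^'+] -->
      (Num.sqrt (1 + 0 ^+ 2) : R)^-1 by exact: (continuous_cvg _ c W_lim).
  by rewrite expr0n addr0 sqrtr1 invr1 in s.
rewrite -(mulr1 l); apply: cvg_trans (cvgM flux_quotient_limit s).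
by apply: near_eq_cvg; near=> h; rewrite /= /mcurv mulrAC.
Unshelve. all: by end_near. Qed.

Let du r := mcurv (W r).

Let dduD r : 0 < r -> is_derive r 1 du (ddu r).
Proof.
by move=> r0; exact: is_derive_comp mcurv W r _ _ (is_derive_mcurv _) (dWD r r0).
Qed.

Let U x : R := u (enorm x).

Let slope := radius_quotient du l.

Lemma partial_radial_solution j x :
  is_derive x (delta_mx 0 j) U (slope (enorm x) * x 0 j).
Proof.
have q : (u h - u 0) / h @[h --> 0^'+] --> (0 : R).
  rewrite u0; apply: (right_derivative_limit u du 1) => //.
    rewrite -[X in _ --> X](mcurv0 (R := R)).
    exact: (continuous_cvg _ (continuous_mcurv 0) W_lim).
  by move=> r /andP[r0 _]; exact: duD.
apply: (is_derive_eq (is_derive_radial u du x j duD q)).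
have [->|x0] := eqVneq x 0; first by rewrite mxE !mulr0.
by rewrite /slope /radius_quotient enorm_gt0.
Qed.

Lemma partial_radial_solutionE j :
  partial j U = fun x => slope (enorm x) * x 0 j.
Proof. by apply/funext => x; case: (partial_radial_solution j x). Qed.

(** The gradient is (u' / r) x, so C^2 regularity reduces to [classC1_radial_coord] for u' / r; its
    condition at 0 holds because u'' and u' / r have the same limit. *)
Lemma classC2_radial_solution : classC2 U.
Proof.
have C1 i : classC1 (fun x => slope (enorm x) * x 0 i).
  apply: (classC1_radial_coord slope (radius_quotient_derivative du ddu)).
  - exact: is_derive_radius_quotient dduD.
  - move=> r r0; apply: (continuous_radius_quotient_derivative _ _ dduD r r0).
    exact: (continuous_second_derivative N p p1 xi u W uW r r0).
  - exact: (radius_quotient_limit _ _ slope_quotient_limit).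
  - exact: (radius_quotient_derivative_limit du ddu l slope_quotient_limit
      second_derivative_limit).
split; last by move=> i; rewrite partial_radial_solutionE.
split.
  move=> x; apply: continuous_radial; last by rewrite u0.
  by move=> r r0; exact: is_derive_continuous (duD r r0).
move=> i; split; first by move=> x; case: (partial_radial_solution i x).
by rewrite partial_radial_solutionE; case: (C1 i).
Qed.

Lemma enormZ (c : R) x : enorm (c *: x) = `|c| * enorm x.
Proof.
rewrite /enorm; under eq_bigr do rewrite mxE exprMn.
by rewrite -mulr_sumr sqrtrM ?sqr_ge0// sqrtr_sqr.
Qed.

Lemma grad_radial_solution x : grad U x = slope (enorm x) *: x.
Proof. by apply/rowP => i; rewrite !mxE partial_radial_solutionE. Qed.

Lemma enorm_grad_radial_solution x : x != 0 ->
  enorm (grad U x) = `|du (enorm x)|.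
Proof.
move=> x0; rewrite grad_radial_solution enormZ /slope /radius_quotient enorm_gt0//.
by rewrite normrM normfV (gtr0_norm (enorm_gt0 x x0)) divfK// gt_eqF ?enorm_gt0.
Qed.

Lemma flux_radial_solution x : flux U x = radius_quotient W l (enorm x) *: x.
Proof.
have [->|x0] := eqVneq x 0.
  by rewrite /flux grad_radial_solution !scaler0.
rewrite /flux enorm_grad_radial_solution// grad_radial_solution scalerA.
rewrite real_normK ?num_real// /slope /radius_quotient enorm_gt0//.
by rewrite mulrA [_^-1 * du _]mulrC mcurvK.
Qed.

(** The divergence of kap(|x|) x is N kap + |x| kap'. For kap = W / r this is W' + k W / r away from
    0, and at the origin it is N l = - f(xi). *)
Lemma divergence_flux_radial_solution x :
  divergence (flux U) x + nonlin p (U x) = 0.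
Proof.
pose kap := radius_quotient W l; pose dkap := radius_quotient_derivative W dW.
have pE i : partial i (fun y => flux U y 0 i) x =
    kap (enorm x) + dkap (enorm x) / enorm x * x 0 i ^+ 2.
  have -> : (fun y => flux U y 0 i) = (fun y => kap (enorm y) * y 0 i).
    by apply/funext => y; rewrite flux_radial_solution mxE.
  have [] := is_derive_radial_coord kap dkap x i i
    (is_derive_radius_quotient W dW l dWD)
    (radius_quotient_limit _ _ flux_quotient_limit).
  by rewrite eqxx mulr1 -expr2.
rewrite /divergence (eq_bigr _ (fun i _ => pE i)) big_split /=.
rewrite sumr_const card_ord -mulr_sumr -enorm_sqr -mulr_natr.
have [->|x0] := eqVneq x 0.
  rewrite /U enorm0 u0 expr0n mulr0 addr0 /kap /radius_quotient ltxx /l.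
  by rewrite mulNr divfK ?gt_eqF// addNr.
have e0 := enorm_gt0 x x0.
rewrite /kap /dkap /radius_quotient e0 /radius_quotient_derivative /dW NE /U -/f.
by field; rewrite gt_eqF.
Qed.

Lemma vanishes_radial_solution : vanishes_at_infinity U.
Proof.
move=> e e0; have /cvgrPdist_lt/(_ e e0) := global_vanishes N p xi u W N3 p1 uW.
case=> M0 [M0r M0P]; exists M0; split => // M M0M x Mx.
by have := M0P (enorm x) (lt_le_trans M0M Mx); rewrite sub0r normrN.
Qed.

Lemma radial_solution_pde : 0 < xi -> (exists2 r, 0 < r & u r < 0) ->
  sign_changing_pde_solution p U.
Proof.
move=> xi0 [r r0 ur]; split.
- exact: classC2_radial_solution.
- move=> x; have [->|x0] := eqVneq x 0.
    by rewrite grad_radial_solution scaler0 enorm0.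
  by rewrite enorm_grad_radial_solution// mcurv_lt1.
- exact: divergence_flux_radial_solution.
- split; apply/eqP/negP => /eqP.
    move=> /(congr1 (fun F => F 0)); rewrite /funrpos /U /= enorm0 u0.
    by rewrite max_l ?ltW// => /eqP; rewrite gt_eqF.
  have N00 : (0 < N)%N by case: N N3.
  move=> /(congr1 (fun F => F (r *: delta_mx 0 (Ordinal N00)))).
  rewrite /funrneg /U /= enorm_axis gtr0_norm// max_l ?oppr_ge0 ?ltW//.
  by move=> /eqP; rewrite oppr_eq0 lt_eqF.
- exact: vanishes_radial_solution.
Qed.

End RadialPDE.

Theorem theorem0p4 (R : realType) (N : nat) (p : R) (hN : (3 <= N)%N)
    (hp : 1 < p) :
  (forall (xi : R) (T : \bar R) (u : R -> R), 0 < xi ->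
     maximal_cauchy_solution N p xi T u -> sign_changing_on T u ->
     T = +oo%E /\ (u r @[r --> +oo] --> (0 : R)))
  /\ infinite_set
       [set u : 'rV[R]_N -> R | radial u /\ sign_changing_pde_solution p u].
Proof.
split=> [xi T u _ um _|].
  have Too := maximal_solution_global N p hN hp xi T u um; split => //.
  case: um => us _; rewrite Too in us.
  apply: (global_vanishes N p xi u (radial_flux u) hN hp) => b.
  by apply: (cauchy_solution_picard N p hN xi b +oo%E u us); rewrite leey.
have k0 : (0 < N.-1)%N by case: N hN => [//|[]].
(* The constant part meets both thresholds of [global_takes_negative]; adding n makes the values at
   the origin distinct. *)
pose xi n : R := 2 + 4 * N%:R * 16 ^+ N.-1 + n%:R.
have c0 : 0 <= 4 * N%:R * 16 ^+ N.-1 :> R by rewrite mulr_ge0 ?exprn_ge0 ?mulr_ge0.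
have solP n : exists u : R -> R, u 0 = xi n /\
    sign_changing_pde_solution p (fun x : 'rV[R]_N => u (enorm x)).
  have [[u W] [/= uW u0 _]] := picard_fixpoint_exists N.-1 (nonlin p) k0
    (nonlin_locally_lipschitz p hp) (continuous_nonlin p hp) (xi n).
  exists u; split; first exact: u0.
  have n0 : 0 <= n%:R :> R by [].
  apply: (radial_solution_pde N p (xi n) u W hN hp uW (u0 0 (lexx _))).
    by rewrite /xi; lra.
  by apply: (global_takes_negative N p (xi n) u W hN hp uW); rewrite /xi; lra.
have [sol sol_spec] := choice solP.
pose U n (x : 'rV[R]_N) := sol n (enorm x).
apply: (@sub_infinite_set _ (range U)).
  by move=> _ [n _ <-]; split; [exists (sol n)|case: (sol_spec n)].
(* [g] recovers the index n from the value at the origin, so a finite range of [U] would make nat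
   finite. *)
pose g (F : 'rV[R]_N -> R) := Num.truncn (F 0 - (2 + 4 * N%:R * 16 ^+ N.-1)).
move=> /(finite_image g); suff -> : g @` range U = [set: nat].
  exact: infinite_nat.
apply/seteqP; split=> // n _; exists (U n); first by exists n.
rewrite /g /U enorm0; have [-> _] := sol_spec n.
by rewrite /xi addrAC subrr add0r natrK.
Qed.
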